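(* Let $\mathcal H$ be a separable infinite-dimensional complex Hilbert space and let $w\colon\mathbb N_0\to\mathbb R_{>0}$ satisfy $w(0)=1$, $w^{-1}\in\ell^2(\mathbb N_0)$, and $w^{-2}*w^{-2}\le C\,w^{-2}$ for some constant $C$. Fix an orthonormal basis $\{\phi_j\}_{j=0}^\infty$ of $\mathcal H$ and a sequence $a=(a_j)_{j\ge0}\in\ell^2(\mathbb N_0)$ with $a_j\ge0$ for all $j$ and $\lVert a\rVert_{\ell^2(\mathbb N_0)}\le R_w$, where $R_w$ is the radius of convergence of $\sum_{n=0}^\infty w^{-2}(n)z^{2n}$. Consider the subset $$\mathbb T_a^{\mathrm{complex}}=\left\{\langle\xi,\cdot\rangle_{F_w(\mathcal H)}:\ \xi=\sum_{n=0}^\infty w^{-2}(n)\Big(\sum_{j=0}^\infty a_jz_j\phi_j\Big)^{\vee n},\ (z_j)_j\in\ell^\infty(\mathbb N_0),\ |z_j|=1\right\}\subset\sigma(F_w(\mathcal H)).$$ Then the restriction $\hat F_w(\mathcal H)|_{\mathbb T_a^{\mathrm{complex}}}$ is a reproducing kernel Hilbert algebra of continuous functions on $\mathbb T_a^{\mathrm{complex}}$, and if $a_j>0$ for all $j$, then $f|_{\mathbb T_a^{\mathrm{complex}}}$ uniquely determines $f\in\hat F_w(\mathcal H)$.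
   Context: Inner products are conjugate-linear in the first argument. The symmetric tensor product is $f_1\vee\cdots\vee f_n=\frac1{n!}\sum_{s\in S_n}f_{s(1)}\otimes\cdots\otimes f_{s(n)}$. $F_w(\mathcal H)$ is the Hilbert space completion of $\mathbb C\oplus\mathcal H\oplus\mathcal H^{\vee2}\oplus\cdots$ ($\mathcal H^{\vee n}$ the symmetric tensors in $\mathcal H^{\otimes n}$) for the inner product in which different degrees are orthogonal, $\langle a,b\rangle=\bar ab$ on $\mathbb C$, and which on $\mathcal H^{\vee n}$ equals $w^2(n)$ times the inner product of $\mathcal H^{\otimes n}$; $f^{\vee0}=\Omega=1\in\mathbb C$. Under the hypotheses on $w$ it is a unital commutative Banach algebra under $\vee$ (for an equivalent norm). Its spectrum $\sigma(F_w(\mathcal H))$ is the set of nonzero multiplicative linear functionals with the weak-$^*$ topology; it equals the set of functionals $\langle\sum_n w^{-2}(n)\eta^{\vee n},\cdot\rangle$ with $\eta\in\mathcal H$, $\lVert\eta\rVert\le R_w$. The Gelfand map $\Gamma\colon F_w(\mathcal H)\to C(\sigma(F_w(\mathcal H)))$, $(\Gamma f)(\chi)=\chi f$, is injective, and $\hat F_w(\mathcal H)=\Gamma(F_w(\mathcal H))$ with the inner product transported from $F_w(\mathcal H)$ is a reproducing kernel Hilbert space with reproducing kernel $\hat k(\chi_1,\chi_2)=\langle\xi_1,\xi_2\rangle_{F_w(\mathcal H)}$, $\chi_i=\langle\xi_i,\cdot\rangle$. For a reproducing kernel Hilbert space $\mathcal G$ on a set $Y$ and $S\subseteq Y$, $\mathcal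 G|_S$ is the space of restrictions to $S$, with the reproducing kernel Hilbert space structure whose kernel is the restriction of the kernel of $\mathcal G$ to $S\times S$. A reproducing kernel Hilbert space $\mathcal G$ on $Y$, with $k_y\in\mathcal G$ the vectors such that $f(y)=\langle k_y,f\rangle_{\mathcal G}$, is a reproducing kernel Hilbert algebra if $k_y\mapsto k_y\otimes k_y$, $y\in Y$, extends to a bounded linear map $\mathcal G\to\mathcal G\otimes\mathcal G$. *)

(* Defs.v *)
From HB Require Import structures.
From mathcomp Require Import all_boot all_order all_algebra all_fingroup.
From mathcomp Require Import all_classical all_reals.
From mathcomp Require Import interval_inference ereal topology normedtype.
From mathcomp Require Import sequences.
From mathcomp Require Import complex sesquilinear spectral.
From mathcomp Require Import ring.

Set Implicit Arguments.
Unset Strict Implicit.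
Unset Printing Implicit Defensive.

Import Order.TTheory GRing.Theory Num.Theory.
Import numFieldNormedType.Exports.

Local Open Scope classical_set_scope.
Local Open Scope ring_scope.

Section ComplexScalars.
Variable R : realType.
Implicit Types (z M e a b : R[i]).

Lemma norm_le_eps0 z M : 0 <= M ->
  (forall e, 0 < e -> e <= 1 -> `|z| <= e * M) -> z = 0.
Proof.
move=> M0 zM; apply/eqP; apply: contraT => z0.
have M1 : 0 < M + 1 by rewrite ltr_wpDl.
have zp : 0 < `|z| by rewrite normr_gt0.
have dp : 0 < (M + 1) + `|z| by rewrite addr_gt0.
have := zM (`|z| / ((M + 1) + `|z|)) (divr_gt0 zp dp).
rewrite ler_pdivrMr// mul1r lerDr (ltW M1) => /(_ isT).
rewrite mulrAC ler_pdivlMr// ler_pM2l// => /le_lt_trans.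
by move=> /(_ (M + 1 + `|z|)); rewrite -addrA ltrDl ltxx addr_gt0// => /(_ isT).
Qed.

Lemma le_eps a b M : 0 <= M ->
  a \is Num.real -> b \is Num.real ->
  (forall e, 0 < e -> e <= 1 -> a <= b + e * M) -> a <= b.
Proof.
move=> M0 ar br abM; rewrite real_leNgt//; apply/negP => ba.
have ab : a - b = 0.
  apply: (norm_le_eps0 M0) => e e0 e1; rewrite gtr0_norm ?subr_gt0//.
  by rewrite lerBlDl; exact: abM.
by move: ba; rewrite -subr_gt0 ab ltxx.
Qed.

Lemma Cauchy_Schwarz_scalar a b z : 0 <= a -> 0 <= b ->
  (forall l : R[i], 0 <= a - l * z - l^* * z^* + l * l^* * b) ->
  `|z| ^+ 2 <= a * b.
Proof.
move=> a0 b0 H; have bR : b^* = b by apply/CrealP; rewrite ger0_real.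
have [b_eq0|bN0] := eqVneq b 0.
  rewrite b_eq0 mulr0 [leLHS](_ : _ = 0)//.
  apply/eqP; apply: contraT => nz.
  have zp : 0 < `|z| ^+ 2 by rewrite lt_neqAle eq_sym nz exprn_ge0.
  have nR : (`|z| ^+ 2)^* = `|z| ^+ 2 by apply/CrealP/ger0_real/ltW.
  have aR : a^* = a by apply/CrealP; rewrite ger0_real.
  have := H ((a + 1) / `|z| ^+ 2 * z^*).
  rewrite b_eq0 mulr0 addr0 !rmorphM/= conjCK fmorphV/= nR rmorphD/= aR rmorph1.
  move: nz; rewrite normCK mulf_eq0 => /norP[z0 zc0].
  have -> : a - (a + 1) / (z * z^*) * z^* * z - (a + 1) / (z * z^*) * z * z^*
    = - (a + 2%:R) by field; rewrite z0 zc0.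
  rewrite oppr_ge0 => a2.
  have : 0 < a + 2%:R by rewrite ltr_wpDl.
  by move/lt_le_trans/(_ a2); rewrite ltxx.
have bp : 0 < b by rewrite lt_neqAle eq_sym bN0.
have := H (z^* / b); rewrite rmorphM/= fmorphV/= conjCK bR.
have -> : a - z^* / b * z - z / b * z^* + z^* / b * (z / b) * b
   = a - z * z^* / b by field.
by rewrite subr_ge0 ler_pdivrMr// normCK.
Qed.


Lemma normC_ReIm z : `|z| <= ((`|complex.Re z|)%:C + (`|complex.Im z|)%:C)%C.
Proof.
rewrite [X in `|X|]complexE (le_trans (ler_normD _ _))// lerD// ?normrM.
  by rewrite normc_def/= expr0n addr0 sqrtr_sqr.
by rewrite !normc_def /= ?expr0n ?addr0 ?add0r ?expr1n ?sqrtr_sqr ?sqrtr1 ?mul1r //.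
Qed.

Lemma Im_le_norm z : ((`|complex.Im z|)%:C)%C <= `|z|.
Proof.
by rewrite normc_def lecR -sqrtr_sqr ler_wsqrtr// lerDr sqr_ge0.
Qed.

Lemma complex_complete (F : set_system R[i]^o) :
  ProperFilter F -> cauchy F -> cvg F.
Proof.
move=> FF /cauchyP Fc.
have cv (f : R[i]^o -> R) : (forall x y, ((`|f x - f y|)%:C)%C <= `|x - y|) ->
    cvg (f @ F).
  move=> fle; apply: R_complete; apply/cauchyP => e e0.
  have [|x Fx] := Fc (e%:C)%C; first by rewrite ltcR.
  exists (f x); change (F (f @^-1` ball (f x) e)).
  apply: filterS Fx => y; rewrite /preimage /= -!ball_normE /= -ltcR.
  by move=> /(le_lt_trans (fle x y)).
have /cvg_ex[/= a Fa] : cvg ((@complex.Re R : R[i]^o -> R) @ F).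
  by apply: cv => x y; rewrite -raddfB /=; exact: normc_ge_Re.
have /cvg_ex[/= b Fb] : cvg ((@complex.Im R : R[i]^o -> R) @ F).
  by apply: cv => x y; rewrite -raddfB /=; exact: Im_le_norm.
apply/cvg_ex; exists ((a +i* b)%C : R[i]^o).
apply/cvgrPdist_lt => e e0.
have [er eE] : exists r, e = (r%:C)%C by exact/complex_realP/gtr0_real.
have er0 : 0 < er / 2 by move: e0; rewrite eE ltcR => ?; rewrite divr_gt0.
near=> x.
have Ra : `|a - complex.Re (x : R[i])| < er / 2.
  by near: x; move/cvgrPdist_lt : Fa; exact.
have Rb : `|b - complex.Im (x : R[i])| < er / 2.
  by near: x; move/cvgrPdist_lt : Fb; exact.
apply: le_lt_trans (normC_ReIm _) _.
rewrite !raddfB/= -rmorphD/= eE ltcR (splitr er) ltrD//.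
Unshelve. all: by end_near. Qed.

Lemma cauchy_complex_seq (x : nat -> R[i]) :
  (forall e : R[i], 0 < e -> exists N, forall n, (N <= n)%N ->
    `|x N - x n| < e) ->
  exists l : R[i]^o, (x : nat -> R[i]^o) @ \oo --> l.
Proof.
move=> xC; apply/cvg_ex; apply: complex_complete.
apply/cauchyP => e /xC[N xN]; exists (x N).
by exists N => // n /= Nn; rewrite -ball_normE; exact: xN.
Qed.

End ComplexScalars.

(* Complex Hilbert spaces; [inner] is conjugate-linear in its first argument
   (by [inner_conj]). *)
HB.mixin Record hasInner (R : realType) H & NormedModule R[i] H := {
  inner : H -> H -> R[i];
  inner_linear : forall (x : H) (c : R[i]) (y z : H),
    inner x (c *: y + z) = c * inner x y + inner x z;
  inner_conj : forall x y : H, inner x y = (inner y x)^*;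
  inner_norm : forall x : H, inner x x = `|x| ^+ 2 }.

#[short(type="hilbertType")]
HB.structure Definition Hilbert (R : realType) :=
  {H of hasInner R H & CompleteNormedModule R[i] H}.

(* The order of [R[i]] makes [0 <= z] include that [z] is real; hermitian
   symmetry follows ([pd_herm]). *)
Record pd_kernel (R : realType) (X : Type) := PDKernel {
  pd_fun :> X -> X -> R[i];
  pd_ge0 : forall s : seq (R[i] * X),
    0 <= \sum_(p <- s) \sum_(q <- s) p.1^* * q.1 * pd_fun p.2 q.2 }.

(* [kernel_space K] is the reproducing kernel Hilbert space on [X] with kernel
   [K], an element being the function [x |-> <k_x, f>], [k_x = kvec x].
   A formal combination [s] stands for the vector [\sum_((c, y) <- s) c *: k_y],
   whose function is [comb_fun s]; [pairing s f] is [<s, f>].  The space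
   consists of the functions that are limits of the [comb_fun t] in the norm
   [sup_s |pairing s _| / |s|], i.e. it is the Hilbert completion of the span
   of abstract vectors [k_x] with [<k_x, k_y> = K x y]; see [kvec_repr],
   [kvec_inner], [kcomb_dense].  Hence it also serves as the model of every
   other Hilbert completion below. *)
Section KernelSpace.
Variables (R : realType) (X : Type) (K : pd_kernel R X).
Local Notation C := R[i].
Implicit Types (s t : seq (C * X)) (f g h : X -> C).

Definition comb_fun s : X -> C := fun x => \sum_(p <- s) p.1 * K x p.2.
Definition pairing s f : C := \sum_(p <- s) p.1^* * f p.2.

Definition kclosure : {pred X -> C} := fun f => `[< forall e : C, 0 < e ->
  exists t, forall s, `|pairing s f - pairing s (comb_fun t)|
    <= e * sqrtC (pairing s (comb_fun s)) >].

Let scs (c : C) s := [seq (c * p.1, p.2) | p <- s].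

Lemma pairing_cat s t f : pairing (s ++ t) f = pairing s f + pairing t f.
Proof. by rewrite /pairing big_cat. Qed.

Lemma pairing_scs c s f : pairing (scs c s) f = c^* * pairing s f.
Proof.
by rewrite /pairing big_map mulr_sumr; apply: eq_bigr => p _ /=; rewrite rmorphM mulrA.
Qed.

Lemma pairing_lin s c f g :
  pairing s (c *: f + g) = c * pairing s f + pairing s g.
Proof.
rewrite /pairing mulr_sumr -big_split; apply: eq_bigr => p _ /=.
by rewrite mulrDr mulrCA.
Qed.

Lemma pairing0 s : pairing s 0 = 0.
Proof. by rewrite /pairing big1// => p _; rewrite mulr0. Qed.

Lemma pairingB s f g : pairing s (f - g) = pairing s f - pairing s g.
Proof.
by rewrite addrC -scaleN1r pairing_lin mulN1r addrC.
Qed.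

Lemma comb_cat s t : comb_fun (s ++ t) = comb_fun s + comb_fun t.
Proof. by apply/funext => x; rewrite /comb_fun big_cat. Qed.

Lemma comb_scs c s : comb_fun (scs c s) = c *: comb_fun s.
Proof.
apply/funext => x; transitivity (c * comb_fun s x) => //.
rewrite /comb_fun big_map mulr_sumr.
by apply: eq_bigr => p _ /=; rewrite mulrA.
Qed.

Lemma comb_nil : comb_fun [::] = 0.
Proof. by apply/funext => x; rewrite /comb_fun big_nil. Qed.

Definition qf s := pairing s (comb_fun s).

Lemma qf_ge0 s : 0 <= qf s.
Proof.
have := pd_ge0 K s; congr (_ <= _); apply: eq_bigr => p _.
by rewrite mulr_sumr; apply: eq_bigr => q _ /=; rewrite mulrA.
Qed.

Lemma pd_herm x y : K y x = (K x y)^*.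
Proof.
have diag z : K z z \is Num.real.
  have := qf_ge0 [:: (1, z)]; rewrite /qf /pairing /comb_fun !big_seq1 /=.
  by rewrite rmorph1 !mul1r => /ger0_real.
have H c : c^* * K y x + c * K x y \is Num.real.
  have /ger0_real := qf_ge0 [:: (1, x); (c, y)].
  rewrite /qf /pairing /comb_fun !big_cons !big_nil /= rmorph1 !addr0 !mul1r.
  have ccR : c^* * c * K y y \is Num.real.
    by rewrite (mulrC c^*) -normCK rpredM// rpredX// normr_real.
  have -> : K x x + c * K x y + c^* * (K y x + c * K y y)
     = c^* * K y x + c * K x y + (K x x + c^* * c * K y y) by ring.
  by move=> /rpredB/(_ (rpredD (diag x) ccR)); rewrite addrK.
have := H 1; have := H 'i; rewrite rmorph1 !mul1r conjCi => /CrealP.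
rewrite rmorphD !rmorphM/= rmorphN/= conjCi opprK => H1 /CrealP.
rewrite rmorphD/= => H2.
have H3 : 'i * ((K y x)^* - (K x y)^* + K y x - K x y) = 0.
  move/eqP: H1; rewrite -subr_eq0 => /eqP H1; rewrite -[RHS]H1; ring.
move/eqP: H3; rewrite mulf_eq0 (negPf (neq0Ci _)) => /eqP H3.
have H4 : 2%:R * (K y x - (K x y)^*) = 0.
  transitivity ((K y x)^* - (K x y)^* + K y x - K x y -
    ((K y x)^* + (K x y)^* - (K y x + K x y))); first by ring.
  by rewrite H3 H2 subrr subr0.
by move/eqP: H4; rewrite mulf_eq0 pnatr_eq0/= subr_eq0 => /eqP.
Qed.

Lemma pairing_comb s t : pairing s (comb_fun t) = (pairing t (comb_fun s))^*.
Proof.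
rewrite /pairing /comb_fun rmorph_sum /=.
under eq_bigr do rewrite mulr_sumr.
rewrite exchange_big /=; apply: eq_bigr => p _.
rewrite rmorphM/= conjCK rmorph_sum mulr_sumr; apply: eq_bigr => q _ /=.
by rewrite rmorphM/= -pd_herm; ring.
Qed.

Let nrm s := sqrtC (qf s).

Let nrm_ge0 s : 0 <= nrm s.
Proof. by rewrite sqrtC_ge0 qf_ge0. Qed.

Let nrm2 s : nrm s ^+ 2 = qf s.
Proof. by rewrite sqrtCK. Qed.

Lemma pairing_CS s t : `|pairing s (comb_fun t)| <= nrm s * nrm t.
Proof.
rewrite -ler_sqr ?nnegrE ?mulr_ge0// exprMn !nrm2.
apply: Cauchy_Schwarz_scalar; rewrite ?qf_ge0// => l.
have := qf_ge0 (s ++ scs (- l) t).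
rewrite /qf comb_cat comb_scs !pairing_cat !pairing_scs.
have lin u c f g : pairing u (f + c *: g) = pairing u f + c * pairing u g.
  by rewrite addrC pairing_lin addrC.
rewrite !lin (pairing_comb t s); congr (_ <= _).
by rewrite rmorphN/=; ring.
Qed.

Definition approx f (e : C) t :=
  forall s, `|pairing s f - pairing s (comb_fun t)| <= e * nrm s.

Lemma approx_comb t : approx (comb_fun t) 0 t.
Proof. by move=> s; rewrite subrr normr0 mul0r. Qed.

Lemma approx_lin c f g e e' t t' : approx f e t -> approx g e' t' ->
  approx (c *: f + g) (`|c| * e + e') (scs c t ++ t').
Proof.
move=> ft gt s; rewrite comb_cat comb_scs !pairing_lin.
rewrite opprD addrACA -mulrBr (le_trans (ler_normD _ _))//.
by rewrite mulrDl lerD// normrM -mulrA ler_wpM2l.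
Qed.

Lemma approxW f e e' t : e <= e' -> approx f e t -> approx f e' t.
Proof. by move=> ee' ft s; apply: le_trans (ft s) _; rewrite ler_wpM2r. Qed.

Fact kclosure_submod : submod_closed kclosure.
Proof.
split=> [|c f g /asboolP fP /asboolP gP]; apply/asboolP => e e0.
  exists [::] => s; rewrite comb_nil subrr normr0.
  by apply: mulr_ge0; [exact: ltW | exact: nrm_ge0].
have c1 : 0 < `|c| + 1 by rewrite ltr_wpDl.
have [|t ft] := fP (e / (`|c| + 1) / 2); first by rewrite !divr_gt0.
have [|t' gt] := gP (e / 2); first by rewrite divr_gt0.
exists (scs c t ++ t'); apply: approxW (approx_lin c ft gt).
rewrite [leRHS](splitr e) lerD2r mulrA ler_pM2r ?invr_gt0// mulrCA ger_pMr//.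
by rewrite ler_pdivrMr// mul1r lerDl.
Qed.

HB.instance Definition _ := GRing.isSubmodClosed.Build C (X -> C) kclosure
  kclosure_submod.

Record kernel_space :=
  KernelSpace { kernel_fun :> X -> C ; kernel_funP : kernel_fun \in kclosure }.

HB.instance Definition _ := [isSub for kernel_fun].
HB.instance Definition _ := [Choice of kernel_space by <:].
HB.instance Definition _ := [SubChoice_isSubLmodule of kernel_space by <:].


Local Notation H := kernel_space.
Implicit Types (u v : H) (M e : C).

Let happrox u e : 0 < e -> exists t, approx u e t.
Proof. by case: u => f /= /asboolP; apply. Qed.

Let inv0 n : 0 < n.+1%:R^-1 :> C. Proof. by rewrite invr_gt0 ltr0n. Qed.

Let inv_lt e : 0 < e -> exists N, forall n, (N <= n)%N -> n.+1%:R^-1 < e.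
Proof.
move=> e0; have [r eE] := complex_realP _ (gtr0_real e0).
have r0 : 0 < r by move: e0; rewrite eE ltcR.
have [N _ NP] := near_infty_natSinv_lt (PosNum r0).
exists N => n Nn; have := NP n Nn; rewrite eE /= -ltcR.
by rewrite fmorphV/= rmorph_nat.
Qed.

Let rep u n := projT1 (cid (happrox u (inv0 n))).
Let repP u n : approx u n.+1%:R^-1 (rep u n).
Proof. exact: (projT2 (cid (happrox u (inv0 n)))). Qed.

Let bdd f M := forall s, `|pairing s f| <= M * nrm s.

Let approx_bdd f e t : approx f e t -> bdd f (e + nrm t).
Proof.
move=> ft s; rewrite -[pairing s f](subrK (pairing s (comb_fun t))).
rewrite (le_trans (ler_normD _ _))// mulrDl lerD//.
by rewrite mulrC pairing_CS.
Qed.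

Let hbdd u : exists2 M, 0 <= M & bdd u M.
Proof.
exists (0.+1%:R^-1 + nrm (rep u 0)); last exact/approx_bdd/repP.
by rewrite addr_ge0// ltW.
Qed.

Let dif t t' := t ++ scs (- 1) t'.

Let pairing_dif t t' f : pairing (dif t t') f = pairing t f - pairing t' f.
Proof. by rewrite pairing_cat pairing_scs rmorphN rmorph1 mulN1r. Qed.

Let nrm_le t M : 0 <= M -> qf t <= M * nrm t -> nrm t <= M.
Proof.
move=> M0; have [->//|n0] := eqVneq (nrm t) 0.
by rewrite -nrm2 expr2 ler_pM2r// lt_neqAle eq_sym n0/=.
Qed.

Let nrm_dif f e e' t t' : 0 <= e + e' -> approx f e t -> approx f e' t' ->
  nrm (dif t t') <= e + e'.
Proof.
move=> ee0 ft ft'; apply: nrm_le => //.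
rewrite -[qf _]ger0_norm ?qf_ge0// /qf {2}/dif comb_cat comb_scs scaleN1r pairingB.
rewrite -(subrKA (pairing (dif t t') f)) (le_trans (ler_normD _ _))//.
by rewrite mulrDl lerD// distrC.
Qed.

Let pairing_dif_le f g e e' t t' M : 0 <= e + e' -> 0 <= M ->
  approx f e t -> approx f e' t' -> bdd g M ->
  `|pairing t g - pairing t' g| <= M * (e + e').
Proof.
move=> ee0 M0 ft ft' gM; rewrite -pairing_dif (le_trans (gM _))//.
by rewrite ler_wpM2l// (nrm_dif _ ft ft').
Qed.

Definition kinner u v : C := lim ((fun n => pairing (rep u n) v : C^o) @ \oo).

Let kinner_cvg u v :
  (fun n => pairing (rep u n) v : C^o) @ \oo --> (kinner u v : C^o).
Proof.
suff [l /cvgP//] : exists l : C^o, (fun n => pairing (rep u n) v : C^o) @ \oo --> l.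
apply: cauchy_complex_seq => e e0.
have [M M0 vM] := hbdd v.
have [|N NP] := inv_lt (e := e / (M + 1) / 2).
  by rewrite !divr_gt0// ltr_wpDl.
exists N => n Nn.
apply: le_lt_trans (pairing_dif_le _ M0 (repP u N) (repP u n) vM) _.
  by rewrite addr_ge0// ltW.
have M1 : 0 < M + 1 by rewrite ltr_wpDl.
apply: (@le_lt_trans _ _ ((M + 1) * (N.+1%:R^-1 + n.+1%:R^-1))).
  by rewrite ler_wpM2r ?lerDl// addr_ge0// ltW.
by rewrite mulrC -ltr_pdivlMr// [ltRHS]splitr ltrD// NP.
Qed.

Let kinner_approx u v e t M : 0 <= e -> 0 <= M -> approx u e t -> bdd v M ->
  `|kinner u v - pairing t v| <= e * M.
Proof.
move=> e0 M0 ut vM; apply: (@le_eps _ _ _ (1 + M)) => //.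
- by rewrite addr_ge0.
- by rewrite ger0_real// mulr_ge0.
move=> d d0 d1; have [N NP] := inv_lt d0.
have /cvgrPdist_le/(_ d d0)[N' _ NP'] := @kinner_cvg u v.
set n := maxn N N'.
have := NP' n (leq_maxr _ _) => /= H1.
have := NP n (leq_maxl _ _) => H2.
rewrite -(subrKA (pairing (rep u n) v)) (le_trans (ler_normD _ _))//.
have -> : e * M + d * (1 + M) = d + M * (d + e) by ring.
rewrite lerD// (le_trans (pairing_dif_le _ M0 (repP u n) ut vM))//.
  by rewrite addr_ge0// ltW.
by rewrite ler_wpM2l// lerD2r ltW.
Qed.

Lemma kinner_linear u (c : C) v w :
  kinner u (c *: v + w) = c * kinner u v + kinner u w.
Proof.
suff /cvg_lim : (fun n => pairing (rep u n) (c *: v + w) : C^o) @ \oo -->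
  (c * kinner u v + kinner u w : C^o) by apply; exact: norm_hausdorff.
have -> : (fun n => pairing (rep u n) (c *: v + w) : C^o) =
   (fun n => c * pairing (rep u n) v + pairing (rep u n) w).
  by apply/funext => n; exact: pairing_lin.
apply: cvgD; last exact: kinner_cvg.
by apply: cvgMr; exact: kinner_cvg.
Qed.

Let nrm_approx f e t M : 0 <= e -> 0 <= M -> approx f e t -> bdd f M ->
  nrm t <= M + e.
Proof.
move=> e0 M0 ft fM; apply: nrm_le; first exact: addr_ge0.
rewrite -[qf _]ger0_norm ?qf_ge0// /qf.
rewrite -[pairing t (comb_fun t)](subrK (pairing t f)) (le_trans (ler_normD _ _))//.
by rewrite addrC mulrDl lerD// distrC.
Qed.

Let kinner_approx2 u v e t t' M : 0 <= e -> 0 <= M ->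
  approx u e t -> approx v e t' -> bdd u M -> bdd v M ->
  `|kinner u v - pairing t (comb_fun t')| <= e * (M + M + e).
Proof.
move=> e0 M0 ut vt uM vM.
rewrite -(subrKA (pairing t v)) (le_trans (ler_normD _ _))//.
rewrite -addrA mulrDr lerD ?(kinner_approx _ _ ut vM)//.
by rewrite (le_trans (vt _))// ler_wpM2l// (nrm_approx _ _ ut uM).
Qed.

Let hbdd2 u v : exists M, [/\ 0 <= M, bdd u M & bdd v M].
Proof.
have [M M0 uM] := hbdd u; have [M' M'0 vM] := hbdd v.
exists (M + M'); split; first exact: addr_ge0.
- by move=> s; rewrite (le_trans (uM s))// ler_wpM2r// lerDl.
- by move=> s; rewrite (le_trans (vM s))// ler_wpM2r// lerDr.
Qed.

Lemma kinner_conj u v : kinner u v = (kinner v u)^*.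
Proof.
have [M [M0 uM vM]] := hbdd2 u v.
apply/eqP; rewrite -subr_eq0; apply/eqP.
apply: (@norm_le_eps0 _ _ (2%:R * (M + M + 1))).
  by rewrite mulr_ge0// !addr_ge0.
move=> e e0 e1; have [t ut] := happrox u e0; have [t' vt] := happrox v e0.
rewrite -(subrKA (pairing t (comb_fun t'))) (le_trans (ler_normD _ _))//.
have H1 : e * (M + M + e) <= e * (M + M + 1) by rewrite ler_pM2l// lerD2l.
rewrite mulrCA mulr_natl mulr2n lerD// (le_trans _ H1)//.
  by apply: kinner_approx2 => //; exact: ltW.
rewrite distrC pairing_comb -rmorphB norm_conjC.
by apply: kinner_approx2 => //; exact: ltW.
Qed.

Lemma kinner_ge0 u : 0 <= kinner u u.
Proof.
have rl : kinner u u \is Num.real by apply/CrealP; rewrite -kinner_conj.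
have [M M0 uM] := hbdd u.
apply: (@le_eps _ _ _ (M + M + 1)) => //; first by rewrite !addr_ge0.
move=> e e0 e1; have [t ut] := happrox u e0.
have := kinner_approx2 (ltW e0) M0 ut ut uM uM; rewrite real_ler_norml; last first.
  by rewrite rpredB// ger0_real// qf_ge0.
case/andP => + _; rewrite lerBrDr addrC lerBlDr => /(le_trans (qf_ge0 t)) H2.
by rewrite (le_trans H2)// lerD2l ler_pM2l// lerD2l.
Qed.

Fact kcomb_subproof s : comb_fun s \in kclosure.
Proof.
apply/asboolP => e e0; exists s; apply: approxW (approx_comb s); exact: ltW.
Qed.
Definition kcomb s : H := KernelSpace (kcomb_subproof s).
Definition kvec x : H := kcomb [:: (1, x)].

Lemma kinner_comb s u : kinner (kcomb s) u = pairing s u.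
Proof.
have [M M0 uM] := hbdd u.
have := kinner_approx (lexx 0) M0 (approx_comb s : approx (kcomb s) 0 s) uM.
by rewrite mul0r normr_le0 subr_eq0 => /eqP.
Qed.

Lemma kinner_repr x u : kinner (kvec x) u = u x.
Proof. by rewrite kinner_comb /pairing big_seq1 rmorph1 mul1r. Qed.

Lemma kinner_kvec x y : kinner (kvec x) (kvec y) = K x y.
Proof. by rewrite kinner_repr /= /comb_fun big_seq1 mul1r. Qed.

Definition knorm u : C := sqrtC (kinner u u).

Lemma knorm_ge0 u : 0 <= knorm u. Proof. by rewrite sqrtC_ge0 kinner_ge0. Qed.

Lemma kinnerDr u v w : kinner u (v + w) = kinner u v + kinner u w.
Proof. by rewrite -[v]scale1r kinner_linear mul1r scale1r. Qed.

Lemma kinner0r u : kinner u 0 = 0.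
Proof. by apply: (addrI (kinner u 0)); rewrite -kinnerDr !addr0. Qed.

Lemma kinnerZr u c v : kinner u (c *: v) = c * kinner u v.
Proof. by rewrite -[c *: v]addr0 kinner_linear kinner0r addr0. Qed.

Lemma kinnerDl u v w : kinner (u + v) w = kinner u w + kinner v w.
Proof. by rewrite kinner_conj kinnerDr rmorphD/= -!kinner_conj. Qed.

Lemma kinnerZl c u v : kinner (c *: u) v = c^* * kinner u v.
Proof. by rewrite kinner_conj kinnerZr rmorphM/= -kinner_conj. Qed.

Lemma kinner_CS u v : `|kinner u v| <= knorm u * knorm v.
Proof.
rewrite -ler_sqr ?nnegrE ?mulr_ge0 ?knorm_ge0// exprMn !sqrtCK.
apply: Cauchy_Schwarz_scalar; rewrite ?kinner_ge0// => l.
have := kinner_ge0 (u + (- l) *: v).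
rewrite !kinnerDr !kinnerDl !kinnerZr !kinnerZl (kinner_conj v u).
by congr (_ <= _); rewrite rmorphN/=; ring.
Qed.

Lemma knormD u v : knorm (u + v) <= knorm u + knorm v.
Proof.
rewrite -ler_sqr ?nnegrE ?addr_ge0 ?knorm_ge0// sqrtCK.
rewrite kinnerDr !kinnerDl sqrrD !sqrtCK.
have -> : kinner u u + kinner v u + (kinner u v + kinner v v) =
  kinner u u + (kinner v u + kinner u v) + kinner v v by ring.
rewrite lerD2r lerD2l mulr2n.
have rl : kinner v u + kinner u v \is Num.real.
  by apply/CrealP; rewrite rmorphD/= -!kinner_conj addrC.
rewrite (le_trans (real_ler_norm rl))// (le_trans (ler_normD _ _))//.
by rewrite lerD ?kinner_CS// mulrC kinner_CS.
Qed.

Lemma knormZ c u : knorm (c *: u) = `|c| * knorm u.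
Proof.
rewrite /knorm kinnerZr kinnerZl mulrA -normCK sqrtCM ?nnegrE ?kinner_ge0 ?exprn_ge0//.
by rewrite sqrCK.
Qed.

Lemma pairing_le s u : `|pairing s u| <= nrm s * knorm u.
Proof.
by rewrite -kinner_comb (le_trans (kinner_CS _ _))// /knorm kinner_comb.
Qed.

Lemma knorm0_eq0 u : knorm u = 0 -> u = 0.
Proof.
move=> u0; apply/val_inj/funext => x /=.
rewrite -kinner_repr; apply/eqP; rewrite -normr_le0.
by rewrite (le_trans (kinner_CS _ _))// u0 mulr0.
Qed.

HB.instance Definition _ :=
  Lmodule_isNormed.Build C H knormD knormZ knorm0_eq0.

Lemma bdd_knorm u M : 0 <= M -> bdd u M -> knorm u <= M.
Proof.
move=> M0 uM; rewrite -ler_sqr ?nnegrE ?knorm_ge0// sqrtCK.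
apply: (@le_eps _ _ _ (M + (M + 1))); rewrite ?ger0_real ?kinner_ge0 ?exprn_ge0//.
  by rewrite !addr_ge0.
move=> e e0 e1; have [t ut] := happrox u e0.
have e0' := ltW e0.
have H1 := kinner_approx e0' M0 ut uM.
have H2 : `|pairing t u| <= M * (M + e).
  by rewrite (le_trans (uM t))// ler_wpM2l// (nrm_approx _ _ ut uM).
rewrite -[leLHS]ger0_norm ?kinner_ge0//.
rewrite -(subrK (pairing t u) (kinner u u)) (le_trans (ler_normD _ _))//.
rewrite (le_trans (lerD H1 H2))//.
have -> : e * M + M * (M + e) = M ^+ 2 + e * (M + M) by ring.
by rewrite lerD2l ler_pM2l// lerD2l lerDl.
Qed.

Lemma pairing_is_cvg (F : set_system H) : ProperFilter F -> cauchy F ->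
  forall s, cvg ((fun u : H => pairing s u : C^o) @ F).
Proof.
move=> FF /cauchyP Fc s; apply: complex_complete; apply/cauchyP => e e0.
have n1 : 0 < nrm s + 1 by rewrite ltr_wpDl ?nrm_ge0.
have [|u Fu] := Fc (e / (nrm s + 1)); first exact: divr_gt0.
exists (pairing s u).
change (F ((fun u : H => pairing s u : C^o) @^-1` ball (pairing s u : C^o) e)).
apply: filterS Fu => v; rewrite /preimage /= -!ball_normE /= => uv.
rewrite -pairingB (le_lt_trans (pairing_le s (u - v)))//.
have : (nrm s + 1) * knorm (u - v) < e by rewrite mulrC -ltr_pdivlMr.
by apply: le_lt_trans; rewrite ler_wpM2r ?knorm_ge0// lerDl.
Qed.

Lemma kernel_space_complete (F : set_system H) :
  ProperFilter F -> cauchy F -> cvg F.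
Proof.
move=> FF Fc; have cv := pairing_is_cvg FF Fc.
pose f x : C := lim ((fun u : H => pairing [:: (1, x)] u : C^o) @ F).
have pf s : (fun u : H => pairing s u : C^o) @ F --> (pairing s f : C^o).
  elim: s => [|p s IH].
    have E : (fun u : H => pairing [::] u : C^o) = (fun=> 0).
      by apply/funext => u; rewrite /pairing big_nil.
    by rewrite E [pairing _ f]big_nil; exact: cvg_cst.
  have c1 : (fun u : H => p.1^* * pairing [:: (1, p.2)] u : C^o) @ F -->
      (p.1^* * f p.2 : C^o) by apply: cvgMr; exact: cv.
  have E : (fun u : H => pairing (p :: s) u : C^o) =
      (fun u : H => (p.1^* * pairing [:: (1, p.2)] u : C^o) +
                    (pairing s u : C^o)).
    apply/funext => u; rewrite [LHS]big_cons; congr (_ + _).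
    by rewrite /pairing big_seq1 rmorph1 mul1r.
  rewrite E [pairing _ f]big_cons.
  exact: (@cvgD C C^o H F _ _ _ _ _ c1 IH).
have key e : 0 < e -> F [set u : H | forall s,
    `|pairing s f - pairing s u| <= e * nrm s].
  move=> e0; have /cauchyP Fc' := Fc.
  have [|v Fv] := Fc' (e / 2); first by rewrite divr_gt0.
  apply: (filterS _ Fv) => u uv s.
  apply: (@le_eps _ _ _ 1) => //.
    by rewrite ger0_real// mulr_ge0 ?nrm_ge0// ltW.
  move=> d d0 d1.
  have /cvgrPdist_le/(_ d d0) pd := pf s.
  have [w [/= ws]] := filter_ex (filterI pd Fv).
  move: uv; rewrite -!ball_normE /= => uv wv.
  rewrite mulr1 [leRHS]addrC -(subrKA (pairing s w)) (le_trans (ler_normD _ _))// lerD//.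
  rewrite -pairingB (le_trans (pairing_le s (w - u)))// mulrC ler_wpM2r ?nrm_ge0//.
  rewrite -[knorm _]/(`|w - u|) -(subrKA v) (le_trans (ler_normD _ _))//.
  by rewrite [leRHS]splitr; apply: lerD; [rewrite distrC|]; exact: ltW.
have fK : f \in kclosure.
  apply/asboolP => e e0; have e2 : 0 < e / 2 by rewrite divr_gt0.
  have [u uf] := filter_ex (key _ e2); have [t ut] := happrox u e2.
  exists t => s; rewrite -(subrKA (pairing s u)) (le_trans (ler_normD _ _))//.
  by rewrite [in leRHS](splitr e) mulrDl; apply: lerD; [exact: uf|exact: ut].
apply/cvg_ex; exists (KernelSpace fK); apply/cvgrPdist_le => e e0.
apply: filterS (key e e0) => u uf /=.
by apply: bdd_knorm => [|s]; [exact: ltW | rewrite pairingB; exact: uf].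
Qed.

HB.instance Definition _ := Uniform_isComplete.Build H kernel_space_complete.

HB.instance Definition _ := hasInner.Build R H kinner_linear kinner_conj
  (fun u => esym (sqrtCK (kinner u u))).

Lemma kvec_repr x u : inner (kvec x) u = u x.
Proof. exact: kinner_repr. Qed.

Lemma kvec_inner x y : inner (kvec x) (kvec y) = K x y.
Proof. exact: kinner_kvec. Qed.

Lemma kcombE s : kcomb s = \sum_(p <- s) p.1 *: kvec p.2.
Proof.
elim: s => [|p s IH].
  by rewrite big_nil; apply/val_inj; exact: comb_nil.
rewrite big_cons -IH; apply/val_inj; apply/funext => x /=.
transitivity (p.1 * comb_fun [:: (1, p.2)] x + comb_fun s x) => //.
by rewrite /comb_fun big_cons big_seq1 mul1r.
Qed.

Lemma kcomb_dense u e : 0 < e -> exists s, `|u - kcomb s| <= e.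
Proof.
move=> e0; have [t ut] := happrox u e0; exists t.
by apply: bdd_knorm => [|s]; [exact: ltW | rewrite pairingB; exact: ut].
Qed.

End KernelSpace.

Section PdKernels.
Variable R : realType.
Local Notation C := R[i].

Lemma pd_ord (X : Type) (K : pd_kernel R X) n (c : 'I_n -> C) (x : 'I_n -> X) :
  0 <= \sum_i \sum_j (c i)^* * c j * K (x i) (x j).
Proof.
have := pd_ge0 K [seq (c i, x i) | i <- enum 'I_n].
rewrite big_map big_enum /=; congr (_ <= _); apply: eq_bigr => i _.
by rewrite big_map big_enum.
Qed.

Lemma pd_mul_subproof (X : Type) (K1 K2 : pd_kernel R X) (s : seq (C * X)) :
  0 <= \sum_(p <- s) \sum_(q <- s) p.1^* * q.1 * (K1 p.2 q.2 * K2 p.2 q.2).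
Proof.
rewrite big_tnth; under eq_bigr do rewrite big_tnth.
set n := size s; pose c i := (tnth (in_tuple s) i).1.
pose x i := (tnth (in_tuple s) i).2.
pose A : 'M[C]_n := \matrix_(i, j) K1 (x i) (x j).
have An : A \is normalmx.
  apply: hermitian_normalmx; apply/is_hermitianmxP.
  by rewrite expr0 scale1r; apply/matrixP => i j; rewrite !mxE pd_herm.
move/orthomx_spectralP : An; set P := spectralmx A; set D := spectral_diag A.
have PU : P \is unitarymx by exact: spectral_unitarymx.
rewrite invmx_unitary// => AE.
have D0 k : 0 <= D 0 k.
  have : diag_mx D = P *m A *m P ^t*%sesqui.
    rewrite AE !mulmxA (unitarymxP PU) mul1mx -mulmxA (unitarymxP PU) mulmx1//.
  move/matrixP/(_ k k); rewrite [LHS]mxE eqxx mulr1n => ->.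
  have := pd_ord K1 (fun i => (P k i)^*) x; congr (_ <= _).
  rewrite exchange_big mxE; apply: eq_bigr => j _.
  rewrite !mxE mulr_suml; apply: eq_bigr => i _.
  by rewrite !mxE conjCK mulrAC.
have -> : \sum_(i < n) \sum_(j < n) (tnth (in_tuple s) i).1^* *
     (tnth (in_tuple s) j).1 * (K1 (tnth (in_tuple s) i).2 (tnth (in_tuple s) j).2
     * K2 (tnth (in_tuple s) i).2 (tnth (in_tuple s) j).2) =
  \sum_k D 0 k * \sum_i \sum_j (P k i * c i)^* * (P k j * c j) * K2 (x i) (x j).
  under [RHS]eq_bigr do rewrite mulr_sumr.
  rewrite [RHS]exchange_big; apply: eq_bigr => i _.
  under [RHS]eq_bigr do rewrite mulr_sumr.
  rewrite [RHS]exchange_big; apply: eq_bigr => j _.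
  have -> : K1 (tnth (in_tuple s) i).2 (tnth (in_tuple s) j).2 = A i j by rewrite mxE.
  rewrite AE mxE mulr_suml mulr_sumr; apply: eq_bigr => k _.
  rewrite mul_mx_diag !mxE rmorphM/= -/(c i) -/(c j) -/(x i) -/(x j).
  by ring.
by apply: sumr_ge0 => k _; rewrite mulr_ge0// pd_ord.
Qed.

Definition pd_mul (X : Type) (K1 K2 : pd_kernel R X) :=
  @PDKernel R X (fun x y => K1 x y * K2 x y) (pd_mul_subproof K1 K2).

Lemma pd_one_subproof (X : Type) (s : seq (C * X)) :
  0 <= \sum_(p <- s) \sum_(q <- s) p.1^* * q.1 * 1.
Proof.
under eq_bigr do (under eq_bigr do rewrite mulr1; rewrite -mulr_sumr).
by rewrite -mulr_suml -rmorph_sum mulrC -normCK exprn_ge0.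
Qed.

Lemma pd_prod_subproof (X : Type) n (K : 'I_n -> pd_kernel R X)
  (s : seq (C * X)) :
  0 <= \sum_(p <- s) \sum_(q <- s) p.1^* * q.1 * \prod_i K i p.2 q.2.
Proof.
suff [K' K'E] : exists K' : pd_kernel R X,
    (K' : X -> X -> C) = fun x y => \prod_i K i x y.
  by have := pd_ge0 K' s; rewrite K'E.
elim: n K => [|n IH] K.
  exists (@PDKernel R X (fun _ _ => 1) (@pd_one_subproof X)).
  by apply/funext => x; apply/funext => y; rewrite big_ord0.
have [K' K'E] := IH (fun i => K (lift ord0 i)).
exists (pd_mul (K ord0) K').
by apply/funext => x; apply/funext => y; rewrite big_ord_recl /= K'E.
Qed.

Section Gram.
Variables (H : hilbertType R).
Implicit Types u v : H.

Lemma innerDr u v v' : inner u (v + v') = inner u v + inner u v'.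
Proof. by have := inner_linear u 1 v v'; rewrite scale1r mul1r. Qed.

Lemma inner0r u : inner u 0 = 0.
Proof. by apply: (addrI (inner u 0)); rewrite -innerDr !addr0. Qed.

Lemma innerZr u c v : inner u (c *: v) = c * inner u v.
Proof. by rewrite -[c *: v]addr0 inner_linear inner0r addr0. Qed.

Lemma innerZl c u v : inner (c *: u) v = c^* * inner u v.
Proof. by rewrite inner_conj innerZr rmorphM/= -inner_conj. Qed.

Lemma inner0l u : inner 0 u = 0.
Proof. by rewrite inner_conj inner0r rmorph0. Qed.

Lemma inner_sumr u I (r : seq I) (F : I -> H) :
  inner u (\sum_(i <- r) F i) = \sum_(i <- r) inner u (F i).
Proof.
by elim: r => [|i r IH]; rewrite ?(big_nil, inner0r)// !big_cons innerDr IH.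
Qed.

Lemma inner_suml u I (r : seq I) (F : I -> H) :
  inner (\sum_(i <- r) F i) u = \sum_(i <- r) inner (F i) u.
Proof.
rewrite inner_conj inner_sumr rmorph_sum; apply: eq_bigr => i _.
by rewrite [RHS]inner_conj.
Qed.

Lemma gram_subproof (X : Type) (v : X -> H) (s : seq (C * X)) :
  0 <= \sum_(p <- s) \sum_(q <- s) p.1^* * q.1 * inner (v p.2) (v q.2).
Proof.
have := exprn_ge0 2 (normr_ge0 (\sum_(p <- s) p.1 *: v p.2)).
rewrite -inner_norm inner_suml; congr (_ <= _); apply: eq_bigr => p _.
rewrite inner_sumr; apply: eq_bigr => q _.
by rewrite innerZl innerZr mulrA.
Qed.

Definition gram (X : Type) (v : X -> H) : pd_kernel R X :=
  @PDKernel R X (fun x y => inner (v x) (v y)) (gram_subproof v).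
End Gram.
End PdKernels.

(* [H1 (x) H2]: completion of the span of simple tensors, where
   [<x1 (x) x2, y1 (x) y2> = <x1, y1> <x2, y2>]. *)
Section Tensor2.
Variables (R : realType) (H1 H2 : hilbertType R).

Definition tensor2_kernel : pd_kernel R (H1 * H2) :=
  pd_mul (gram (fst : H1 * H2 -> H1)) (gram (snd : H1 * H2 -> H2)).

Definition tensor2 : hilbertType R := kernel_space tensor2_kernel.

Definition tens2 (x1 : H1) (x2 : H2) : tensor2 := kvec tensor2_kernel (x1, x2).

End Tensor2.

Section TensorPower.
Variables (R : realType) (H : hilbertType R) (n : nat).

Definition tensor_kernel : pd_kernel R ('I_n -> H) :=
  @PDKernel R ('I_n -> H) (fun f g => \prod_i inner (f i) (g i))
    (pd_prod_subproof (fun i => gram (fun f : 'I_n -> H => f i))).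

Definition tensor_power : hilbertType R := kernel_space tensor_kernel.

Definition tens (f : 'I_n -> H) : tensor_power := kvec tensor_kernel f.

Definition symtens (f : 'I_n -> H) : tensor_power :=
  (n`!%:R)^-1 *: \sum_(s : 'S_n) tens (f \o s).

End TensorPower.

Section Fock.
Variables (R : realType) (H : hilbertType R) (w : nat -> R).

(* The word [[:: f1; ...; fn]] stands for [f1 \/ ... \/ fn], placed in degree
   [n]; these vectors span the algebraic direct sum, and [[::]] is [Omega]. *)
Definition word_inner (s t : seq H) : R[i] :=
  if size s == size t then
    ((w (size s) ^+ 2)%:C)%C *
      inner (symtens (fun i : 'I_(size s) => nth 0 s i))
            (symtens (fun i : 'I_(size s) => nth 0 t i))
  else 0.

Lemma word_inner_subproof (s : seq (R[i] * seq H)) :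
  0 <= \sum_(p <- s) \sum_(q <- s) p.1^* * q.1 * word_inner p.2 q.2.
Proof.
pose v n (t : seq H) := if size t == n
  then symtens (fun i : 'I_n => nth 0 t i) else 0.
pose N := (\max_(p <- s) size p.2).+1.
have wE p q : p \in s -> word_inner p.2 q.2 =
    \sum_(n < N) ((w n ^+ 2)%:C)%C * inner (v n p.2) (v n q.2).
  move=> ps; have pN : (size p.2 < N)%N by rewrite ltnS; exact: leq_bigmax_seq.
  rewrite (bigD1 (Ordinal pN))//= big1 ?addr0 => [|n nN]; last first.
    rewrite {1}/v ifN ?inner0l ?mulr0//.
    by apply: contra nN => /eqP pn; apply/eqP/val_inj.
  rewrite /word_inner /v eqxx eq_sym.
  by case: ifP => // _; rewrite inner0r mulr0.
have -> : \sum_(p <- s) \sum_(q <- s) p.1^* * q.1 * word_inner p.2 q.2 =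
    \sum_(n < N) ((w n ^+ 2)%:C)%C *
      \sum_(p <- s) \sum_(q <- s) p.1^* * q.1 * inner (v n p.2) (v n q.2).
  under [RHS]eq_bigr do rewrite mulr_sumr.
  rewrite [RHS]exchange_big; apply: eq_big_seq => p ps.
  under [RHS]eq_bigr do rewrite mulr_sumr.
  rewrite [RHS]exchange_big; apply: eq_bigr => q _.
  by rewrite wE// mulr_sumr; apply: eq_bigr => n _; rewrite mulrCA.
apply: sumr_ge0 => n _; rewrite mulr_ge0 ?gram_subproof//.
by rewrite ler0c sqr_ge0.
Qed.

Definition fock_kernel : pd_kernel R (seq H) := PDKernel word_inner_subproof.

Definition fock : hilbertType R := kernel_space fock_kernel.

Definition wedge (s : seq H) : fock := kvec fock_kernel s.

(* The product of [fock] is the unique bounded bilinear extension of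
   [(f1 \/ ... \/ fm) \/ (g1 \/ ... \/ gn)]; it exists when
   [w^-2 * w^-2 <= C w^-2].  Otherwise [fock_mul] has a junk value. *)
Definition is_fock_product (m : fock -> fock -> fock) :=
  [/\ forall f c g h, m f (c *: g + h) = c *: m f g + m f h,
      forall f c g h, m (c *: g + h) f = c *: m g f + m h f,
      exists M : R[i], forall f g, `|m f g| <= M * `|f| * `|g| &
      forall s t, m (wedge s) (wedge t) = wedge (s ++ t)].

Definition fock_mul : fock -> fock -> fock :=
  xget (fun _ _ => 0) is_fock_product.

Definition is_character (chi : fock -> R[i]) :=
  [/\ forall c f g, chi (c *: f + g) = c * chi f + chi g,
      exists f, chi f != 0 &
      forall f g, chi (fock_mul f g) = chi f * chi g].

(* [{ptws _ -> _}] carries the topology of pointwise convergence, which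
   restricts to the weak-* topology. *)
Definition spectrum : topologicalType :=
  set_type ([set chi | is_character chi] : set {ptws fock -> R[i]^o}).

Definition gelfand (f : fock) : spectrum -> R[i] := fun chi => set_val chi f.

Definition riesz (chi : spectrum) : fock :=
  xget 0 [set xi : fock | forall f, set_val chi f = inner xi f].

Definition khat : pd_kernel R spectrum := gram riesz.

Definition fock_exp (eta : H) : fock :=
  limn (series (fun n => ((w n ^- 2)%:C)%C *: wedge (nseq n eta))).

Definition fock_radius : \bar R :=
  ereal_sup [set r%:E | r in [set r : R | 0 <= r /\
    cvgn (series (fun n => w n ^- 2 * r ^+ (2 * n)))]].

End Fock.

Section Restriction.
Variables (R : realType) (Y : Type) (K : pd_kernel R Y) (A : set Y).

Lemma pd_restrict_subproof (s : seq (R[i] * A)) :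
  0 <= \sum_(p <- s) \sum_(q <- s)
         p.1^* * q.1 * K (set_val p.2) (set_val q.2).
Proof.
have := pd_ge0 K [seq (p.1, set_val p.2) | p <- s].
rewrite big_map /=; congr (_ <= _); apply: eq_bigr => p _.
by rewrite big_map.
Qed.

Definition pd_restrict : pd_kernel R A :=
  @PDKernel R A (fun y y' => K (set_val y) (set_val y')) pd_restrict_subproof.

End Restriction.

(* Every reproducing kernel Hilbert space is the [kernel_space] of its kernel. *)
Definition is_rkha (R : realType) (Y : Type) (K : pd_kernel R Y) :=
  exists Delta : {linear kernel_space K -> tensor2 (kernel_space K) (kernel_space K)},
    (exists M : R[i], forall f, `|Delta f| <= M * `|f|) /\
    forall y, Delta (kvec K y) = tens2 (kvec K y) (kvec K y).

Definition is_orthonormal_basis (R : realType) (H : hilbertType R)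
    (phi : nat -> H) :=
  (forall i j, inner (phi i) (phi j) = (i == j)%:R) /\
  (forall x : H, series (fun j => inner (phi j) x *: phi j) @ \oo --> x).

Section Torus.
Variables (R : realType) (H : hilbertType R) (w : nat -> R).
Variables (phi : nat -> H) (a : nat -> R).

Definition torus_vector (z : nat -> R[i]) : fock H w :=
  fock_exp w (limn (series (fun j => ((a j)%:C)%C * z j *: phi j))).

Definition complex_torus : set (spectrum H w) :=
  [set chi | exists z : nat -> R[i], (forall j, `|z j| = 1) /\
    forall f, set_val chi f = inner (torus_vector z) f].

End Torus.

Arguments complex_torus {R H} w phi a _.

(* Main.v *)
(* Write u n = w n ^- 2 and xi_eta = fock_exp w eta, so that
   <xi_eta, f1 \/ ... \/ fn> = prod <eta, fi> and
   <xi_eta, xi_theta> = G(eta, theta) = sum u n <eta, theta>^n.  Expanding the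
   square, u * u <= C u and the positivity of the kernels <eta, theta>^n give
   G^2 <= C G as kernels.  By itself this is the boundedness of
   k_chi |-> k_chi (x) k_chi.

   If f is orthogonal to every xi_eta with eta = sum a_j z_j phi_j, |z_j| = 1,
   a_j > 0, then reading <xi_eta, f> as a power series in one conjugate variable
   z_j after the other kills the pairing of f with every word in the phi_j, so
   f = 0.  Used for an auxiliary sequence a, this totality turns G^2 <= C G into
   the existence of the Fock product (the bounded map characterised by
   <xi_eta, f \/ g> = <xi_eta, f> <xi_eta, g>), and used for the given a it is
   the uniqueness claim.

   The same bound (sum_n u n r^(2n))^2 <= C sum_n u n r^(2n) shows that the
   series still converges at the radius of convergence. *)

Require Import Defs.
From HB Require Import structures.
From mathcomp Require Import all_boot all_order all_algebra all_fingroup.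
From mathcomp Require Import all_classical all_reals.
From mathcomp Require Import interval_inference ereal topology normedtype.
From mathcomp Require Import sequences.
From mathcomp Require Import complex.
From mathcomp Require Import separable cyclic cyclotomic.
From mathcomp Require Import ring lra.

Set Implicit Arguments.
Unset Strict Implicit.
Unset Printing Implicit Defensive.

Import Order.TTheory GRing.Theory Num.Theory.
Import numFieldNormedType.Exports.

Local Open Scope classical_set_scope.
Local Open Scope ring_scope.

(** * Hilbert spaces *)

Section HilbertSpace.
Variables (R : realType) (H : hilbertType R).
Local Notation C := R[i].
Implicit Types x y : H.

Lemma innerBr x y y' : inner x (y - y') = inner x y - inner x y'.
Proof. by rewrite -scaleN1r innerDr innerZr mulN1r. Qed.

Lemma innerDl x x' y : inner (x + x') y = inner x y + inner x' y.
Proof. by rewrite inner_conj innerDr rmorphD/= -!inner_conj. Qed.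

Lemma innerBl x x' y : inner (x - x') y = inner x y - inner x' y.
Proof. by rewrite inner_conj innerBr rmorphB/= -!inner_conj. Qed.

Lemma inner_CS x y : `|inner x y| <= `|x| * `|y|.
Proof.
rewrite -ler_sqr ?nnegrE ?mulr_ge0// exprMn.
apply: Cauchy_Schwarz_scalar; rewrite ?exprn_ge0// => l.
have := exprn_ge0 2 (normr_ge0 (x - l *: y)).
rewrite -inner_norm !(innerBl, innerBr, innerZl, innerZr) -!inner_norm.
by rewrite (inner_conj y x); congr (_ <= _); ring.
Qed.

Lemma inner_inj y y' : (forall x, inner x y = inner x y') -> y = y'.
Proof.
move=> yy'; apply/eqP; rewrite -subr_eq0 -normr_eq0 -sqrf_eq0 -inner_norm.
by rewrite innerBr yy' subrr.
Qed.

Lemma inner_cvgr x (y_ : nat -> H) y :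
  y_ @ \oo --> y -> (fun n => inner x (y_ n) : C^o) @ \oo --> (inner x y : C^o).
Proof.
move=> yy; apply/cvgrPdist_le => e e0.
have x1 : 0 < `|x| + 1 by rewrite ltr_wpDl.
move/cvgrPdist_le : yy => /(_ (e / (`|x| + 1)) (divr_gt0 e0 x1)).
apply: filterS => n yn; rewrite -innerBr (le_trans (inner_CS _ _))//.
apply: (@le_trans _ _ ((`|x| + 1) * `|y - y_ n|)).
  by rewrite ler_wpM2r// lerDl.
by rewrite mulrC -ler_pdivlMr.
Qed.

Lemma conj_cvg (z_ : nat -> C) (z : C) :
  (z_ : nat -> C^o) @ \oo --> (z : C^o) ->
  (fun n => (z_ n)^* : C^o) @ \oo --> (z^* : C^o).
Proof.
move=> zz; apply/cvgrPdist_le => e e0; move/cvgrPdist_le : zz => /(_ e e0).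
by apply: filterS => n; rewrite -rmorphB norm_conjC.
Qed.

Lemma inner_cvgl x (y_ : nat -> H) y :
  y_ @ \oo --> y -> (fun n => inner (y_ n) x : C^o) @ \oo --> (inner y x : C^o).
Proof.
move=> /(inner_cvgr (x := x))/conj_cvg; rewrite -inner_conj.
by under eq_fun do rewrite -inner_conj.
Qed.

Lemma cauchy_seq_cvg (y_ : nat -> H) :
  (forall e : C, 0 < e -> exists N, forall n, (N <= n)%N -> `|y_ N - y_ n| <= e) ->
  cvgn y_.
Proof.
move=> yC; apply: cauchy_cvg; apply/cauchyP => e e0.
have [|N yN] := yC (e / 2); first exact: divr_gt0.
exists (y_ N); exists N => // n /= /yN yn; rewrite -ball_normE /=.
by rewrite (le_lt_trans yn)// ltr_pdivrMr// ltr_pMr// ltr1n.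
Qed.

Lemma cvg_norm_le (y_ : nat -> H) y (M : C) (N : nat) :
  y_ @ \oo --> y -> (forall n, (N <= n)%N -> `|y_ n| <= M) -> `|y| <= M.
Proof.
move=> yy yM; have M0 : 0 <= M by exact: le_trans (normr_ge0 _) (yM N _).
apply: (@le_eps _ _ _ 1) => //; rewrite ?ger0_real// => e e0 _.
move/cvgrPdist_le : yy => /(_ e e0)[N' _ NP].
rewrite mulr1 -(subrK (y_ (maxn N N')) y) (le_trans (ler_normD _ _))//.
by rewrite addrC lerD ?yM ?leq_maxl//; apply: NP; rewrite /= leq_maxr.
Qed.

Lemma norm_sum2 (X : Type) (v : X -> H) (s : seq (C * X)) :
  `|\sum_(p <- s) p.1 *: v p.2| ^+ 2 =
  \sum_(p <- s) \sum_(q <- s) p.1^* * q.1 * inner (v p.2) (v q.2).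
Proof.
rewrite -inner_norm inner_suml; apply: eq_bigr => p _.
rewrite inner_sumr; apply: eq_bigr => q _.
by rewrite innerZl innerZr mulrA.
Qed.

Lemma inner_comb (X : Type) (v : X -> H) (s : seq (C * X)) y :
  inner (\sum_(p <- s) p.1 *: v p.2) y = \sum_(p <- s) p.1^* * inner (v p.2) y.
Proof. by rewrite inner_suml; apply: eq_bigr => p _; rewrite innerZl. Qed.

(* Near-minimisers of the energy [|V s|^2 - 2 Re (P s)] of the combinations [V s]
   of the [v x] form a Cauchy sequence, whose limit represents [h]. *)
Section Interpolation.
Variables (X : Type) (v : X -> H) (h : X -> C) (M : C).
Hypothesis M0 : 0 <= M.
Let V (s : seq (C * X)) : H := \sum_(p <- s) p.1 *: v p.2.
Let P (s : seq (C * X)) : C := \sum_(p <- s) p.1^* * h p.2.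
Hypothesis hM : forall s, `|P s| <= M * `|V s|.

Let E (s : seq (C * X)) : C := `|V s| ^+ 2 - P s - (P s)^*.

Let E_real s : E s \is Num.real.
Proof.
apply/CrealP; rewrite /E !rmorphB/= conjCK.
by rewrite (CrealP _) ?ger0_real ?exprn_ge0// addrAC.
Qed.

Let E_ge s : - M ^+ 2 <= E s.
Proof.
have PR : P s + (P s)^* \is Num.real.
  by apply/CrealP; rewrite rmorphD/= conjCK addrC.
rewrite /E -addrA -opprD lerBrDr -subr_ge0.
have H1 : P s + (P s)^* <= M * `|V s| *+ 2.
  rewrite (le_trans (real_ler_norm PR))// (le_trans (ler_normD _ _))//.
  by rewrite mulr2n lerD// norm_conjC.
have /le_trans : 0 <= (M - `|V s|) ^+ 2.
  by rewrite real_exprn_even_ge0// rpredB// ger0_real.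
apply; rewrite sqrrB.
have -> : `|V s| ^+ 2 - (- M ^+ 2 + (P s + (P s)^*)) =
  M ^+ 2 - (P s + (P s)^*) + `|V s| ^+ 2 by ring.
by rewrite lerD2r lerD2l lerN2.
Qed.

(** First-order condition at an almost minimal [t]: moving [t] by a multiple of [s] lowers [E] by at
    most [e ^+ 2], so a quadratic in [l] is nonnegative, and its discriminant bound is the claim. *)
Let near_min (e : C) : 0 < e -> exists t, forall s,
  `|P s - inner (V s) (V t)| <= e * `|V s|.
Proof.
move=> e0; have e0' := ltW e0.
have e20 : 0 < complex.Re (e ^+ 2).
  by rewrite -ltcR RRe_real ?exprn_gt0// ger0_real// exprn_ge0.
(* [E] takes real values inside [C], so the infimum is taken of the real parts. *)
have hi : has_inf [set complex.Re (E s) | s in setT].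
  split; first by exists (complex.Re (E [::])), [::].
  exists (complex.Re (- M ^+ 2)) => _ [s _ <-]; rewrite -lecR !RRe_real//.
  by rewrite rpredN ger0_real ?exprn_ge0.
have [_ [t _ <-] tE] := inf_adherent e20 hi; exists t => s.
have minE s' : E t <= E s' + e ^+ 2.
  rewrite -[E t]RRe_real// -[E s']RRe_real// -[e ^+ 2]RRe_real; last first.
    by rewrite ger0_real ?exprn_ge0.
  rewrite -rmorphD/= lecR (le_trans (ltW tE))// lerD2r.
  by apply: ge_inf; [case: hi | exists s'].
rewrite -ler_sqr ?nnegrE ?mulr_ge0// exprMn.
apply: Cauchy_Schwarz_scalar; rewrite ?exprn_ge0// => l.
have := minE (t ++ [seq (l^* * p.1, p.2) | p <- s]).
rewrite -subr_ge0; congr (_ <= _).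
have VE : V (t ++ [seq (l^* * p.1, p.2) | p <- s]) = V t + l^* *: V s.
  rewrite /V big_cat/= big_map scaler_sumr; congr (_ + _).
  by apply: eq_bigr => p _; rewrite scalerA.
have PE : P (t ++ [seq (l^* * p.1, p.2) | p <- s]) = P t + l * P s.
  rewrite /P big_cat/= big_map mulr_sumr; congr (_ + _).
  by apply: eq_bigr => p _; rewrite /= rmorphM/= conjCK mulrA.
rewrite /E VE PE -!inner_norm !innerDl !innerDr !innerZl !innerZr !conjCK.
rewrite (inner_conj (V t) (V s)) !(rmorphD, rmorphM, rmorphB)/=.
by ring.
Qed.

(** A Riesz-type statement for data prescribed on the [v x]. The bound on formal combinations
    already contains the consistency of the data. It yields adjoints, the Fock product and the
    passage between kernel spaces. *)
Lemma interpolation : exists2 y, (forall x : X, inner (v x) y = h x) & `|y| <= M.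
Proof.
have inv0 n : 0 < n.+1%:R^-1 :> C by rewrite invr_gt0 ltr0n.
pose t n := projT1 (cid (near_min (inv0 n))).
have tP n s : `|P s - inner (V s) (V (t n))| <= n.+1%:R^-1 * `|V s|.
  exact: projT2 (cid (near_min (inv0 n))) s.
have inv_le e : 0 < e -> exists N, forall n, (N <= n)%N -> n.+1%:R^-1 <= e :> C.
  move=> e0; have [r eE] := complex_realP _ (gtr0_real e0).
  have r0 : 0 < r by move: e0; rewrite eE ltcR.
  have [N _ NP] := near_infty_natSinv_lt (PosNum r0).
  exists N => n Nn; have := NP n Nn => /ltW; rewrite eE /= -lecR.
  by rewrite fmorphV/= rmorph_nat.
(* With [V s = V (t n) - V (t m)], the inner products of [V s] with [V (t n)] and with [V (t m)] are
   both close to [P s], and they differ by the squared norm of [V s]. *)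
have dist n m : `|V (t n) - V (t m)| <= n.+1%:R^-1 + m.+1%:R^-1.
  pose s := t n ++ [seq (- p.1, p.2) | p <- t m].
  have Vs : V s = V (t n) - V (t m).
    rewrite /V big_cat/= big_map -sumrN; congr (_ + _).
    by apply: eq_bigr => p _; rewrite scaleNr.
  have [->|sN0] := eqVneq (V (t n) - V (t m)) 0.
    by rewrite normr0 addr_ge0// ltW.
  rewrite -(@ler_pM2r _ `|V s|) ?Vs ?normr_gt0// -expr2 -inner_norm.
  rewrite -{1}Vs innerBr -[leLHS]ger0_norm; last first.
    by rewrite -innerBr Vs inner_norm exprn_ge0.
  rewrite -(subrKA (P s)) (le_trans (ler_normD _ _))// mulrDl.
  by rewrite -Vs lerD ?tP// distrC tP.
have /cvg_ex[y yP] : cvgn (V \o t).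
  apply: cauchy_seq_cvg => e e0.
  have [|N NP] := inv_le (e / 2); first exact: divr_gt0.
  exists N => n Nn; rewrite (le_trans (dist _ _))// [leRHS]splitr.
  by rewrite lerD// NP.
have yE s : inner (V s) y = P s.
  apply/eqP; rewrite -subr_eq0; apply/eqP.
  apply: (@norm_le_eps0 _ _ (`|V s| + 1)) => [|e e0 _]; first exact: addr_ge0.
  have [N NP] := inv_le _ e0.
  have /cvgrPdist_le/(_ e e0)[N' _ N'P] := inner_cvgr (x := V s) yP.
  rewrite -(subrKA (inner (V s) (V (t (maxn N N'))))) (le_trans (ler_normD _ _))//.
  rewrite mulrDr mulr1 [leRHS]addrC lerD ?N'P//= ?leq_maxr//.
  by rewrite distrC (le_trans (tP _ _))// ler_wpM2r// NP// leq_maxl.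
exists y.
  move=> x; have := yE [:: (1, x)].
  by rewrite /V /P !big_seq1 scale1r rmorph1 mul1r.
(* Norm bound: [<V (t n), y> = P (t n)] is at most [M * |V (t n)|] in modulus; the two sides tend to
   [|y| ^+ 2] and [M * |y|]. *)
have [->|yN0] := eqVneq y 0; first by rewrite normr0.
rewrite -(@ler_pM2r _ `|y|) ?normr_gt0// -expr2 -inner_norm.
have cv : (fun n => inner (V (t n)) y : C^o) @ \oo --> (inner y y : C^o).
  exact: (inner_cvgl (x := y) yP).
have nv : ((fun n => M * `|V (t n)| : C^o) @ \oo --> (M * `|y| : C^o)).
  by apply: cvgMr; exact: cvg_norm yP.
apply: (@le_eps _ _ _ 2%:R) => //.
- by rewrite ger0_real ?inner_norm ?exprn_ge0.
- by rewrite ger0_real ?mulr_ge0.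
move=> e e0 _.
move/cvgrPdist_le : cv => /(_ e e0)[N _ NP].
move/cvgrPdist_le : nv => /(_ e e0)[N' _ N'P].
set n := maxn N N'; have := NP n (leq_maxl _ _); have := N'P n (leq_maxr _ _) => /= h1 h2.
rewrite -[leLHS]ger0_norm ?inner_norm ?exprn_ge0// -inner_norm.
rewrite -(subrK (inner (V (t n)) y) (inner y y)) (le_trans (ler_normD _ _))//.
have h3 : M * `|V (t n)| <= M * `|y| + e.
  have R1 : M * `|V (t n)| - M * `|y| \is Num.real by rewrite rpredB ?ger0_real ?mulr_ge0.
  by rewrite -lerBlDl (le_trans (real_ler_norm R1))// distrC.
have h4 : `|inner (V (t n)) y| <= M * `|y| + e.
  by rewrite yE (le_trans (hM _)).
by rewrite (le_trans (lerD h2 h4))// mulr_natr mulr2n addrCA.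
Qed.

End Interpolation.
End HilbertSpace.

(** [A] is the adjoint of the map [B] with [<v x, B u> = <g x, u>]. The bound on combinations gives
    [B u] by interpolation; totality of the [v x] makes it unique, hence linear in [u]. *)
Lemma bounded_extension (R : realType) (H1 H2 : hilbertType R) (X : Type)
    (v : X -> H1) (g : X -> H2) (M : R[i]) : 0 <= M ->
  (forall y, (forall x, inner (v x) y = 0) -> y = 0) ->
  (forall s : seq (R[i] * X), `|\sum_(p <- s) p.1 *: g p.2| <=
     M * `|\sum_(p <- s) p.1 *: v p.2|) ->
  exists A : {linear H1 -> H2},
    (forall f, `|A f| <= M * `|f|) /\ (forall x, A (v x) = g x).
Proof.
move=> M0 vtot gv.
have totE y y' : (forall x, inner (v x) y = inner (v x) y') -> y = y'.
  move=> yy'; apply/eqP; rewrite -subr_eq0; apply/eqP/vtot => x.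
  by rewrite innerBr yy' subrr.
have adj u : exists2 y, (forall x, inner (v x) y = inner (g x) u) & `|y| <= M * `|u|.
  apply: interpolation => [|s]; first exact: mulr_ge0.
  rewrite -inner_comb (le_trans (inner_CS _ _))//.
  by rewrite mulrAC ler_wpM2r.
pose B u := s2val (cid2 (adj u)).
have BE u x : inner (v x) (B u) = inner (g x) u := s2valP (cid2 (adj u)) x.
have BM u : `|B u| <= M * `|u| := s2valP' (cid2 (adj u)).
have Blin c u u' : B (c *: u + u') = c *: B u + B u'.
  by apply: totE => x; rewrite innerDr innerZr !BE innerDr innerZr.
have B0 : B 0 = 0 by apply: totE => x; rewrite BE !inner0r.
have Bcomb (s : seq (R[i] * H2)) : \sum_(p <- s) p.1 *: B p.2 = B (\sum_(p <- s) p.1 *: p.2).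
  by elim: s => [|p s IH]; rewrite ?big_nil// !big_cons Blin IH.
(* A second interpolation, now over all vectors [u], represents [u |-> <B u, f>]. *)
have ext f : exists2 y, (forall u, inner u y = inner (B u) f) & `|y| <= M * `|f|.
  apply: (interpolation (v := id)) => [|s]; first exact: mulr_ge0.
  rewrite -inner_comb Bcomb (le_trans (inner_CS _ _))//.
  by rewrite mulrAC ler_wpM2r.
pose A f := s2val (cid2 (ext f)).
have AE f u : inner u (A f) = inner (B u) f := s2valP (cid2 (ext f)) u.
have AM f : `|A f| <= M * `|f| := s2valP' (cid2 (ext f)).
have Alin : linear A.
  by move=> c f f'; apply: inner_inj => u; rewrite AE !(innerDr, innerZr) !AE.
pose L := GRing.isLinear.Build _ _ _ _ A Alin.
pose A' : {linear H1 -> H2} := HB.pack A L.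
exists A'; split=> // x; apply: inner_inj => u.
by rewrite AE inner_conj BE -inner_conj.
Qed.

(** * Words in the Fock space *)

(** [X^n - 1] is separable in characteristic 0, so it has [n] distinct roots, and these include a
    primitive one. *)
Lemma prim_root_exists (F : numClosedFieldType) n :
  (0 < n)%N -> exists z : F, n.-primitive_root z.
Proof.
move=> n0; have [r rE] := closed_field_poly_normal ('X^n - 1 : {poly F}).
rewrite (monicP (monicXnsubC 1 n0)) scale1r in rE.
have r_uniq : uniq r.
  by rewrite -separable_prod_XsubC -rE separable_Xn_sub_1// pnatr_eq0 -lt0n.
have r_size : size r = n.
  by apply/succn_inj; rewrite -(size_prod_XsubC r id) -rE size_XnsubC.
have r_root : all n.-unity_root r.
  by apply/allP => z; rewrite -root_prod_XsubC -rE.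
have /hasP[z _ zn] : has n.-primitive_root r by apply: has_prim_root; rewrite ?r_size.
by exists z.
Qed.

(* Average the polynomial against a character of the group of [d]-th roots of
   unity. *)
Lemma circle_coef_le (F : numClosedFieldType) d (c : nat -> F) (M : F) :
  (forall z, `|z| = 1 -> `|\sum_(k < d) c k * z ^+ k| <= M) ->
  forall k, (k < d)%N -> `|c k| <= M.
Proof.
move=> cM k kd; have d0 : (0 < d)%N by exact: leq_trans kd.
have [x xd] := prim_root_exists F d0.
have x1 : `|x| = 1.
  apply/eqP; rewrite -(@pexpr_eq1 _ _ d)//.
  by rewrite -normrX (prim_expr_order xd) normr1.
have xN0 : x != 0 by rewrite -normr_eq0 x1 oner_eq0.
have ck : \sum_(m < d) x ^- (k * m) * (\sum_(j < d) c j * (x ^+ m) ^+ j) =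
    d%:R * c k.
  under eq_bigr do rewrite mulr_sumr.
  rewrite exchange_big/= (bigD1 (Ordinal kd))//= [X in _ + X]big1 ?addr0.
    rewrite (eq_bigr (fun=> c k)) ?sumr_const ?card_ord ?mulr_natl// => m _.
    by rewrite -exprM mulnC mulrCA mulVf ?mulr1// expf_neq0.
  (* For [j != k] the sum is geometric with ratio [q], a [d]-th root of unity other than 1 because
     [j, k < d]. *)
  move=> j jk; pose q := x ^+ j / x ^+ k.
  have q1 : q != 1.
    apply: contra jk => /eqP qE; apply/eqP/val_inj => /=; apply/eqP.
    have : x ^+ j == x ^+ k by rewrite -(divfK (expf_neq0 k xN0) (x ^+ j)) -/q qE mul1r.
    by rewrite (eq_prim_root_expr xd) !modn_small.
  rewrite (eq_bigr (fun m : 'I_d => c j * q ^+ m)) => [|m _]; last first.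
    rewrite mulrCA; congr (_ * _); rewrite /q exprMn exprVn -!exprM.
    by rewrite mulrC [(m * j)%N]mulnC.
  have /eqP : (q - 1) * \sum_(m < d) q ^+ m = 0.
    rewrite -subrX1 /q exprMn exprVn -!exprM ![(_ * d)%N]mulnC !exprM.
    by rewrite (prim_expr_order xd) !expr1n divr1 subrr.
  by rewrite mulf_eq0 subr_eq0 (negPf q1) -mulr_sumr => /eqP ->; rewrite mulr0.
have dC : 0 < d%:R :> F by rewrite ltr0n.
rewrite -(ler_pM2l dC) -[d%:R in leLHS]gtr0_norm// -normrM -ck.
rewrite (le_trans (ler_norm_sum _ _ _))//.
rewrite mulr_natl -[d in leRHS]card_ord -sumr_const ler_sum// => m _.
by rewrite normrM normfV normrX x1 expr1n invr1 mul1r cM// normrX x1 expr1n.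
Qed.

Section Words.
Variables (R : realType) (H : hilbertType R) (w : nat -> R).
Local Notation C := R[i].
Local Notation wedge := (@wedge R H w).

(** The permanent formula: after reindexing, the inner sum no longer depends on the second
    permutation, so one of the two factors [1/n!] cancels. *)
Lemma inner_symtens n (f g : 'I_n -> H) : inner (symtens f) (symtens g) =
  (n`!%:R)^-1 * \sum_(s : 'S_n) \prod_i inner (f (s i)) (g i).
Proof.
have nN0 : n`!%:R != 0 :> C by rewrite pnatr_eq0 -lt0n fact_gt0.
rewrite /symtens innerZl innerZr fmorphV rmorph_nat; congr (_ * _).
rewrite inner_suml; under eq_bigr do rewrite inner_sumr.
rewrite exchange_big /=.
rewrite (eq_bigr (fun=> \sum_(s : 'S_n) \prod_i inner (f (s i)) (g i))).
  by rewrite sumr_const card_Sn -[(\sum_(_ : 'S_n) _) *+ _]mulr_natl mulKf.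
move=> t _; rewrite (reindex_inj (mulgI t)); apply: eq_bigr => s _.
rewrite kvec_inner /= (reindex_inj (@perm_inj _ t^-1)).
by apply: eq_bigr => i _; rewrite !permM !permKV.
Qed.

Lemma inner_wedge r s : inner (wedge r) (wedge s) =
  if size r == size s then
    (w (size s) ^+ 2)%:C%C * ((size s)`!%:R)^-1 *
    \sum_(p : 'S_(size s)) \prod_i inner (nth 0 r (p i)) (nth 0 s i)
  else 0.
Proof.
rewrite kvec_inner /= /word_inner; case: eqP => // rs.
by rewrite {}rs inner_symtens mulrA.
Qed.

Lemma fock_ext (f g : fock H w) :
  (forall s, inner (wedge s) f = inner (wedge s) g) -> f = g.
Proof.
by move=> fg; apply/val_inj/funext => s; have := fg s; rewrite !kvec_repr.
Qed.

Lemma wedge_perm s t : perm_eq s t -> wedge s = wedge t.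
Proof.
move=> st; apply: fock_ext => r; rewrite !inner_wedge.
have /tuple_permP[p pE] : perm_eq s (in_tuple t) by [].
rewrite (perm_size st); case: eqP => // _; congr (_ * _).
have sE i : nth 0 s (i : 'I_(size t)) = nth 0 t (p i).
  by rewrite pE -tnth_nth tnth_mktuple (tnth_nth 0).
rewrite (reindex_inj (mulgI p)); apply: eq_bigr => q _.
rewrite [RHS](reindex_inj (@perm_inj _ p)); apply: eq_bigr => i _.
by rewrite permM sE.
Qed.

Lemma wedge_linear c x y s :
  wedge (c *: x + y :: s) = c *: wedge (x :: s) + wedge (y :: s).
Proof.
apply: fock_ext => r; rewrite innerDr innerZr !inner_wedge /=.
case: eqP => [_|]; last by rewrite mulr0 addr0.
rewrite mulrCA -mulrDr; congr (_ * _); rewrite mulr_sumr -big_split.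
apply: eq_bigr => p _; rewrite !big_ord_recl /= innerDr innerZr.
by rewrite mulrDl mulrA.
Qed.

(** By Cauchy-Schwarz each of the [n!] terms of the permanent is at most the product of the squared
    norms. *)
Lemma norm_wedge s : (forall n, 0 < w n) ->
  `|wedge s| <= (w (size s))%:C%C * \prod_(x <- s) `|x|.
Proof.
move=> w0; have wC : 0 <= (w (size s))%:C%C :> C by rewrite ler0c ltW.
rewrite -ler_sqr ?nnegrE ?mulr_ge0 ?prodr_ge0// exprMn -inner_norm inner_wedge.
rewrite eqxx -mulrA rmorphXn/= ler_wpM2l ?exprn_ge0//.
set n := size s; have nC : 0 < n`!%:R :> C by rewrite ltr0n fact_gt0.
rewrite mulrC ler_pdivrMr// (le_trans (real_ler_norm _))//.
  (* The permanent is real, being [n!] times a squared norm. *)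
  have := inner_symtens (fun i : 'I_n => nth 0 s i) (fun i : 'I_n => nth 0 s i).
  move/(canLR (mulVKf (lt0r_neq0 nC))) => <-.
  by rewrite rpredM ?realn// inner_norm ger0_real ?exprn_ge0.
rewrite (le_trans (ler_norm_sum _ _ _))// mulrC mulr_natl -card_Sn -sumr_const.
apply: ler_sum => p _; rewrite normr_prod.
rewrite (big_nth 0) big_mkord expr2.
rewrite [X in _ <= X * _](reindex_inj (@perm_inj _ p)) -big_split.
apply: ler_prod => i _; rewrite normr_ge0 /=. exact: inner_CS.
Qed.

Lemma inner_wedge_nseq n x s : inner (wedge (nseq n x)) (wedge s) =
  if n == size s then (w n ^+ 2)%:C%C * \prod_(y <- s) inner x y else 0.
Proof.
rewrite inner_wedge size_nseq; case: eqP => // ->; rewrite -mulrA; congr (_ * _).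
rewrite [X in _ * X = _](eq_bigr (fun=> \prod_(y <- s) inner x y)) => [|p _].
  by rewrite sumr_const card_Sn -[(\prod_(_ <- s) _) *+ _]mulr_natl mulKf//
    pnatr_eq0 -lt0n fact_gt0.
rewrite [RHS](big_nth 0) big_mkord; apply: eq_bigr => i _.
by rewrite nth_nseq ltn_ord.
Qed.

Lemma perm_cat_cons (T : eqType) (s1 s2 : seq T) x :
  perm_eq (s1 ++ x :: s2) (x :: s1 ++ s2).
Proof. by rewrite -[x :: s2]cat1s perm_catCA. Qed.

(** Binomial theorem for symmetric powers, by Pascal's rule; the prefix [s] absorbs the factor split
    off at each step of the induction. *)
Lemma wedge_binomial n c x y s : wedge (s ++ nseq n (y + c *: x)) =
  \sum_(k < n.+1) ('C(n, k)%:R * c ^+ k) *: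
    wedge ((s ++ nseq k x) ++ nseq (n - k) y).
Proof.
elim: n s => [|n IH] s; first by rewrite big_ord1 /= bin0 expr0 mulr1 scale1r !cats0.
have -> : wedge (s ++ nseq n.+1 (y + c *: x)) =
    c *: wedge ((x :: s) ++ nseq n (y + c *: x)) +
    wedge ((y :: s) ++ nseq n (y + c *: x)).
  rewrite -wedge_linear [c *: x + y]addrC; exact/wedge_perm/perm_cat_cons.
rewrite !IH {IH} [RHS]big_ord_recl /= bin0 expr0 mulr1 scale1r cats0.
rewrite [X in _ = _ + X](eq_bigr (fun k : 'I_n.+1 => ('C(n, k.+1)%:R * c ^+ k.+1) *:
    wedge ((s ++ nseq k.+1 x) ++ nseq (n - k) y) +
    ('C(n, k)%:R * c ^+ k.+1) *:
    wedge ((s ++ nseq k.+1 x) ++ nseq (n - k) y))) => [|k _]; last first.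
  by rewrite /bump /= !add1n subSS binS natrD mulrDl scalerDl.
rewrite big_split /= addrA addrC; congr (_ + _).
  rewrite scaler_sumr; apply: eq_bigr => k _.
  rewrite scalerA mulrCA -exprS; congr (_ *: _); apply: wedge_perm.
  by rewrite -cat_cons perm_cat2r perm_sym perm_cat_cons.
(* The shifted sum may keep its last index because ['C(n, n.+1) = 0]. *)
have ext (G : nat -> fock H w) : \sum_(k < n.+1) 'C(n, k)%:R *: G k =
    G 0%N + \sum_(k < n.+1) 'C(n, k.+1)%:R *: G k.+1.
  rewrite big_ord_recl /= bin0 scale1r; congr (_ + _).
  by rewrite [RHS]big_ord_recr /= bin_small// scale0r addr0.
under eq_bigr do rewrite -scalerA.
under [in RHS]eq_bigr do rewrite -scalerA.
rewrite (ext (fun k => c ^+ k *: wedge (((y :: s) ++ nseq k x) ++ nseq (n - k) y))).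
rewrite expr0 scale1r cats0 subn0; congr (_ + _).
  by apply: wedge_perm; rewrite perm_sym perm_cat_cons.
apply: eq_bigr => k _; have [kn|kn] := ltnP k n; last first.
  by rewrite bin_small// !scale0r.
congr (_ *: (_ *: _)); apply: wedge_perm.
by rewrite -(subnSK kn) /= perm_sym perm_cat_cons.
Qed.

End Words.

(** * The radius of convergence *)

Lemma cvg_exprn (F : numFieldType) (s : nat -> F) (l : F) n :
  (s : nat -> F^o) @ \oo --> (l : F^o) ->
  (fun k => s k ^+ n : F^o) @ \oo --> (l ^+ n : F^o).
Proof.
move=> sl; elim: n => [|n IH]; first exact: cvg_cst.
by under eq_fun do rewrite exprS; rewrite exprS; exact: cvgM.
Qed.

(** Pairs with [k, l < L] satisfy [k + l < L + L]. This compares the square of a partial sum with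
    the partial sums of a Cauchy product. *)
Lemma sum_square_le_triangle (F : numDomainType) (f : nat -> nat -> F) L :
  (forall k l, 0 <= f k l) ->
  \sum_(0 <= k < L) \sum_(0 <= l < L) f k l <=
  \sum_(0 <= n < L + L) \sum_(0 <= k < n.+1) f k (n - k)%N.
Proof.
move=> f0; set N := (L + L)%N.
have -> : \sum_(0 <= n < N) \sum_(0 <= k < n.+1) f k (n - k)%N =
    \sum_(0 <= k < N) \sum_(0 <= n < N | (k <= n)%N) f k (n - k)%N.
  rewrite [RHS](exchange_big_dep predT)//=; apply: eq_big_nat => n /andP[_ nN].
  by rewrite (big_nat_widen _ _ N)//; apply: eq_bigl => k; rewrite ltnS.
rewrite (big_cat_nat (leq0n L) (leq_addr L L))/= ler_wpDr//.
  by apply: sumr_ge0 => k _; apply: sumr_ge0.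
apply: ler_sum_nat => k /andP[_ kL].
rewrite -[leRHS](big_nat_widenl k 0 N predT (fun n => f k (n - k)%N))//.
rewrite -{2}[k]add0n big_addn.
have LN : (L <= N - k)%N by rewrite leq_subRL ?(leq_trans (ltnW kL)) ?leq_addr// leq_add2r ltnW.
rewrite [leRHS](big_cat_nat (leq0n L) LN)/= ler_wpDr//.
  by apply: sumr_ge0.
by apply: ler_sum_nat => l _; rewrite addnK.
Qed.

Section Radius.
Variables (R : realType) (w : nat -> R) (K : R).
Hypothesis w_gt0 : forall n, 0 < w n.
Hypothesis w_conv : forall n,
  \sum_(k < n.+1) w k ^- 2 * w (n - k)%N ^- 2 <= K * w n ^- 2.

Let weight_ge0 n : 0 <= w n ^- 2.
Proof. by rewrite invr_ge0 exprn_ge0// ltW. Qed.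

Let term_ge0 (r : R) n : 0 <= r -> 0 <= w n ^- 2 * r ^+ (2 * n).
Proof. by move=> r0; rewrite mulr_ge0 ?exprn_ge0. Qed.

Lemma conv_const_gt0 : 0 < K.
Proof.
have := w_conv 0; rewrite big_ord1 subnn ler_pM2r ?invr_gt0 ?exprn_gt0//.
by apply: lt_le_trans; rewrite invr_gt0 exprn_gt0.
Qed.

(** The convolution bound gives [s k ^+ 2 <= K * s (k + k)]; in the limit [l ^+ 2 <= K * l], so the
    sum is at most [K], whatever [r] is. *)
Let partial_bound r : 0 <= r ->
  cvgn (series (fun n => w n ^- 2 * r ^+ (2 * n))) ->
  forall L, series (fun n => w n ^- 2 * r ^+ (2 * n)) L <= K.
Proof.
move=> r0; set s := series _ => sc L.
have nd : nondecreasing_seq s.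
  by apply: nondecreasing_series => n _ _; exact: term_ge0.
have sl k : s k <= limn s by exact: nondecreasing_cvgn_le.
have sq k : s k ^+ 2 <= K * limn s.
  rewrite (@le_trans _ _ (K * s (k + k)%N))//; last first.
    by rewrite ler_pM2l ?conv_const_gt0.
  rewrite expr2 {1}/s /series /= mulr_suml; under eq_bigr do rewrite mulr_sumr.
  apply: le_trans (sum_square_le_triangle _ _) _.
    by move=> i j; rewrite mulr_ge0 ?term_ge0.
  rewrite mulr_sumr; apply: ler_sum_nat => n _.
  have -> : \sum_(0 <= i < n.+1) w i ^- 2 * r ^+ (2 * i) *
        (w (n - i)%N ^- 2 * r ^+ (2 * (n - i))) =
      (\sum_(i < n.+1) w i ^- 2 * w (n - i)%N ^- 2) * r ^+ (2 * n).
    rewrite big_mkord mulr_suml; apply: eq_bigr => i _.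
    have -> : (2 * n = 2 * i + 2 * (n - i))%N by rewrite -mulnDr subnKC// -ltnS.
    by rewrite exprD; ring.
  by rewrite mulrA ler_wpM2r ?exprn_ge0.
apply: le_trans (sl L) _; set l := limn s.
have [l0|l0] := leP l 0; first exact: le_trans l0 (ltW conv_const_gt0).
rewrite -(ler_pM2r l0) -expr2.
have sl2 : (fun n => s n ^+ 2) @ \oo --> l ^+ 2.
  exact: cvg_exprn.
have := limr_le (cvgP _ sl2) (nearW _ sq); rewrite (cvg_lim _ sl2)//; exact.
Qed.

(** The bound [K] is uniform below the radius, and each partial sum is continuous in [r], so the
    bound persists at the radius itself. *)
Lemma radius_cvg r : cvgn (series (fun n => w n ^- 2)) -> 0 <= r ->
  (r%:E <= fock_radius w)%E -> cvgn (series (fun n => w n ^- 2 * r ^+ (2 * n))).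
Proof.
move=> w1 r0 rw.
(* The alternative [t <= 1] rests on the summability of [w n ^- 2]. It settles [r <= 1], in
   particular [r = 0], which cannot be approached from below. *)
have below t : 0 <= t -> t < r \/ t <= 1 ->
    forall L, series (fun n => w n ^- 2 * t ^+ (2 * n)) L <= K.
  move=> t0 tr L.
  have [r' [r'0 tr' r'c]] : exists r', [/\ 0 <= r', t <= r' &
      cvgn (series (fun n => w n ^- 2 * r' ^+ (2 * n)))].
    case: tr => [tr|t1]; last first.
      by exists 1; split => //; under eq_fun do rewrite expr1n mulr1.
    have := @ereal_sup_gt _ [set x%:E | x in [set x : R | 0 <= x /\
      cvgn (series (fun n => w n ^- 2 * x ^+ (2 * n)))]] t%:E.
    case; first by rewrite (lt_le_trans _ rw)// lte_fin.
    move=> _ [x [x0 xc] <-]; rewrite lte_fin => tx; exists x; split => //.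
    exact: ltW.
  apply: le_trans (partial_bound r'0 r'c L); apply: ler_sum_nat => n _.
  by rewrite ler_wpM2l// lerXn2r// nnegrE.
suff bnd L : series (fun n => w n ^- 2 * r ^+ (2 * n)) L <= K.
  apply: nondecreasing_is_cvgn.
    by apply: nondecreasing_series => n _ _; exact: term_ge0.
  by exists K => _ [L _ <-].
have [r1|r1] := leP r 1; first by apply: below => //; right.
set P := series _ L.
(* Scaling [r] by [1 - 1/(m+1)] multiplies the term of degree [n < L] by the power [2n <= 2L] of
   that number, hence at least by the factor kept here. *)
have tP m : (1 - m.+1%:R^-1) ^+ (2 * L) * P <= K.
  have m0 : 0 < m.+1%:R^-1 :> R by rewrite invr_gt0.
  have m1 : 0 <= 1 - m.+1%:R^-1 :> R by rewrite subr_ge0 invf_le1// ler1n.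
  apply: le_trans (below ((1 - m.+1%:R^-1) * r) _ _ L); first last.
  - by left; rewrite gtr_pMl ?(lt_trans _ r1)// gtrBl.
  - by rewrite mulr_ge0.
  rewrite /P /series /= mulr_sumr; apply: ler_sum_nat => n /andP[_ nL].
  rewrite exprMn mulrCA ler_wpM2l//.
  apply: ler_wpM2r; first exact: exprn_ge0.
  by apply: ler_wiXn2l => //; rewrite leq_mul2l ltnW.
have tl : (fun m => (1 - m.+1%:R^-1) ^+ (2 * L) * P) @ \oo --> (1 - 0) ^+ (2 * L) * P.
  apply: cvgMl; apply: cvg_exprn.
  by apply: cvgB; [exact: cvg_cst | exact: cvg_harmonic].
have := limr_le (cvgP _ tl) (nearW _ tP); rewrite (cvg_lim _ tl)// => h.
by have := h _ _; rewrite subr0 expr1n mul1r; apply.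
Qed.
End Radius.

(** * Exponential vectors *)

Lemma cvg_sum_seq (F : numFieldType) (I : Type) (r : seq I)
    (f : I -> nat -> F) (g : I -> F) :
  (forall i, (f i : nat -> F^o) @ \oo --> (g i : F^o)) ->
  (fun n => \sum_(i <- r) f i n : F^o) @ \oo --> (\sum_(i <- r) g i : F^o).
Proof.
move=> fg; elim: r => [|i r IH].
  by under eq_fun do rewrite big_nil; rewrite big_nil; exact: cvg_cst.
by under eq_fun do rewrite big_cons; rewrite big_cons; exact: cvgD.
Qed.

Lemma cvg_complex_ge0 (R : realType) (y_ : nat -> R[i]) (y : R[i]) :
  (y_ : nat -> R[i]^o) @ \oo --> (y : R[i]^o) -> (forall n, 0 <= y_ n) -> 0 <= y.
Proof.
move=> yy y0; have -> : y = `|y|; last exact: normr_ge0.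
apply/eqP; rewrite -subr_eq0; apply/eqP.
apply: (@norm_le_eps0 _ _ 2%:R) => // e e0 _.
move/cvgrPdist_le : yy => /(_ e e0)[N _ /(_ N (leqnn N)) yN].
rewrite -(subrKA (y_ N)) (le_trans (ler_normD _ _))// mulr_natr mulr2n lerD//.
by rewrite -[X in `|X - _|](ger0_norm (y0 N)) (le_trans (ler_dist_dist _ _))// distrC.
Qed.

(** Schur product theorem: powers of a Gram kernel are positive semidefinite. *)
Lemma quadratic_power_ge0 (R : realType) (H : hilbertType R) (X : Type)
    (e : X -> H) (s : seq (R[i] * X)) n :
  0 <= \sum_(p <- s) \sum_(q <- s) p.1^* * q.1 * inner (e p.2) (e q.2) ^+ n.
Proof.
have := pd_prod_subproof (fun _ : 'I_n => gram e) s; congr (_ <= _).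
by apply: eq_bigr => p _; apply: eq_bigr => q _; rewrite prodr_const card_ord.
Qed.

Section Exponentials.
Variables (R : realType) (H : hilbertType R) (w : nat -> R) (rho : R).
Hypothesis w_gt0 : forall n, 0 < w n.
Hypothesis rho_cvg : cvgn (series (fun n => w n ^- 2 * rho ^+ (2 * n))).
Local Notation C := R[i].
Local Notation wedge := (@wedge R H w).
Local Notation u n := ((w n ^- 2)%:C%C : C).
Let S eta := series (fun n => u n *: wedge (nseq n eta)).
Implicit Types eta : H.

Let u_ge0 n : 0 <= u n.
Proof. by rewrite ler0c invr_ge0 exprn_ge0// ltW. Qed.

Let uC n : (u n)^* = u n.
Proof. by apply/CrealP/ger0_real. Qed.

Let uw n : u n * (w n ^+ 2)%:C%C = 1.
Proof. by rewrite -rmorphM/= mulVf ?rmorph1// expf_neq0// gt_eqF. Qed.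

Let norm_partial m k eta :
  `|\sum_(m <= n < k) u n *: wedge (nseq n eta)| ^+ 2 =
  \sum_(m <= n < k) u n * `|eta| ^+ (2 * n).
Proof.
rewrite -inner_norm inner_suml; apply: eq_big_nat => n nmk.
rewrite inner_sumr (bigD1_seq n) ?mem_index_iota ?iota_uniq//= big1 ?addr0.
  rewrite innerZl innerZr uC inner_wedge_nseq size_nseq eqxx.
  congr (_ * _); rewrite mulrA uw mul1r.
  by rewrite big_nseq -Monoid.iteropE inner_norm exprM.
move=> j jn; rewrite innerZl innerZr inner_wedge_nseq size_nseq.
by rewrite eq_sym (negPf jn) !mulr0.
Qed.

(** Degrees are orthogonal, so the squared norm of a block is a block of the series of
    [u n * |eta| ^+ (2 * n)], dominated by the one at [rho]. Hence [N] does not depend on [eta]. *)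
Let partial_tail (e : C) : 0 < e -> exists N, forall m k eta, (N <= m <= k)%N ->
  `|eta| <= rho%:C%C -> `|S eta k - S eta m| <= e.
Proof.
move=> e0; have e20 : 0 < e ^+ 2 by rewrite exprn_gt0.
have [d dE] := complex_realP _ (gtr0_real e20).
have d0 : 0 < d by move: e20; rewrite dE ltcR.
have /cauchy_cvgP/cauchy_seriesP/(_ _ d0) := rho_cvg.
case=> -[A B] [/= [NA _ AP] [NB _ BP]] AB.
exists (maxn NA NB) => m k eta /andP[Nm mk] eta_rho.
have mkd : `|\sum_(m <= n < k) w n ^- 2 * rho ^+ (2 * n)| < d.
  apply: (AB (m, k)); split; [apply: AP|apply: BP] => /=.
    by rewrite (leq_trans _ Nm)// leq_maxl.
  by rewrite (leq_trans _ mk)// (leq_trans _ Nm)// leq_maxr.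
have -> : S eta k - S eta m = \sum_(m <= n < k) u n *: wedge (nseq n eta).
  by rewrite /S sub_series_geq.
rewrite -ler_sqr ?nnegrE ?(ltW e0)// norm_partial dE.
apply: le_trans (_ : (\sum_(m <= n < k) w n ^- 2 * rho ^+ (2 * n))%:C%C <= _).
  rewrite rmorph_sum; apply: ler_sum => n _; rewrite rmorphM/= rmorphXn/=.
  by rewrite ler_wpM2l// lerXn2r// nnegrE// (le_trans _ eta_rho).
by rewrite lecR (le_trans (ler_norm _))// ltW.
Qed.

Lemma fock_exp_cvg eta : `|eta| <= rho%:C%C ->
  S eta @ \oo --> fock_exp w eta.
Proof.
move=> eta_rho; apply: cauchy_seq_cvg => e e0.
have [N NP] := partial_tail e0; exists N => n Nn; rewrite distrC.
by apply: NP; rewrite ?leqnn.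
Qed.

Lemma fock_exp_tail (e : C) : 0 < e -> exists N, forall m eta, (N <= m)%N ->
  `|eta| <= rho%:C%C -> `|fock_exp w eta - S eta m| <= e.
Proof.
move=> e0; have [N NP] := partial_tail e0; exists N => m eta Nm eta_rho.
have cv : (fun k => S eta k - S eta m) @ \oo --> fock_exp w eta - S eta m.
  by apply: cvgB; [exact: fock_exp_cvg | exact: cvg_cst].
by apply: (cvg_norm_le cv (N := m)) => k mk; apply: NP; rewrite ?Nm.
Qed.

(** Only the degree [size s] contributes, and there [u n] cancels the weight [w n ^+ 2]. That the
    value is a product over the word is the source of multiplicativity. *)
Lemma inner_fock_exp_wedge eta s : `|eta| <= rho%:C%C ->
  inner (fock_exp w eta) (wedge s) = \prod_(x <- s) inner eta x.
Proof.
move=> /fock_exp_cvg /(inner_cvgl (x := wedge s)) cv.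
apply: (cvg_unique _ cv); first exact: norm_hausdorff.
apply: cvg_near_cst; exists (size s).+1 => // n /= sn.
rewrite /S /series /= inner_suml (bigD1_seq (size s)) ?iota_uniq//=; last first.
  by rewrite mem_index_iota.
rewrite innerZl uC inner_wedge_nseq eqxx mulrA uw mul1r [X in _ + X]big1 ?addr0// => k kn.
by rewrite innerZl inner_wedge_nseq (negPf kn) mulr0.
Qed.

Lemma inner_fock_exp_cvg eta theta : `|eta| <= rho%:C%C ->
  `|theta| <= rho%:C%C ->
  (fun L => \sum_(0 <= n < L) u n * inner eta theta ^+ n : C^o) @ \oo -->
  (inner (fock_exp w eta) (fock_exp w theta) : C^o).
Proof.
move=> eta_rho /fock_exp_cvg /(inner_cvgr (x := fock_exp w eta)) cv.
suff SE : (fun L => \sum_(0 <= n < L) u n * inner eta theta ^+ n) =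
  (fun L => inner (fock_exp w eta) (S theta L)) by rewrite SE.
apply/funext => L; rewrite /S /series /= inner_sumr; apply: eq_bigr => n _.
by rewrite innerZr inner_fock_exp_wedge// big_nseq -Monoid.iteropE.
Qed.

Lemma fock_exp_kernel_sq (K : R) (X : Type) (e : X -> H) (s : seq (C * X)) :
  (forall n, \sum_(k < n.+1) w k ^- 2 * w (n - k)%N ^- 2 <= K * w n ^- 2) ->
  (forall x, `|e x| <= rho%:C%C) ->
  \sum_(p <- s) \sum_(q <- s) p.1^* * q.1 *
     inner (fock_exp w (e p.2)) (fock_exp w (e q.2)) ^+ 2 <=
  K%:C%C * \sum_(p <- s) \sum_(q <- s) p.1^* * q.1 *
     inner (fock_exp w (e p.2)) (fock_exp w (e q.2)).
Proof.
move=> wK e_rho; rewrite -subr_ge0.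
pose G L x y : C := \sum_(0 <= n < L) u n * inner (e x) (e y) ^+ n.
pose Q n := \sum_(p <- s) \sum_(q <- s) p.1^* * q.1 * inner (e p.2) (e q.2) ^+ n.
have Q0 n : 0 <= Q n by exact: quadratic_power_ge0.
have quad_cvg (F : nat -> X -> X -> C) (G0 : X -> X -> C) :
    (forall x y, (fun L => F L x y : C^o) @ \oo --> (G0 x y : C^o)) ->
    (fun L => \sum_(p <- s) \sum_(q <- s) p.1^* * q.1 * F L p.2 q.2 : C^o) @ \oo -->
    (\sum_(p <- s) \sum_(q <- s) p.1^* * q.1 * G0 p.2 q.2 : C^o).
  move=> FG; apply: cvg_sum_seq => p; apply: cvg_sum_seq => q.
  by apply: cvgMr; exact: FG.
have Gcvg x y := inner_fock_exp_cvg (e_rho x) (e_rho y).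
have double : (fun L => (L + L)%N) @ \oo --> \oo.
  apply/cvgnyPge => A; exists A => // n /= /leq_trans; apply; exact: leq_addr.
(* The difference is a limit of differences of partial sums, cut at [L + L] and at [L]: the square
   [k, l < L] lies in the triangle [k + l < L + L], and the convolution bound applies degree by
   degree since each [Q n] is nonnegative. *)
apply: (@cvg_complex_ge0 _ (fun L =>
  K%:C%C * (\sum_(p <- s) \sum_(q <- s) p.1^* * q.1 * G (L + L)%N p.2 q.2) -
  \sum_(p <- s) \sum_(q <- s) p.1^* * q.1 * G L p.2 q.2 ^+ 2)) => [|L].
  apply: cvgB.
    apply: cvgMr; apply: (quad_cvg (fun L => G (L + L)%N)
      (fun x y => inner (fock_exp w (e x)) (fock_exp w (e y)))) => x y.
    exact: cvg_comp double (Gcvg x y).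
  apply: (quad_cvg (fun L x y => G L x y ^+ 2)
    (fun x y => inner (fock_exp w (e x)) (fock_exp w (e y)) ^+ 2)) => x y.
  by apply: cvg_exprn; exact: Gcvg.
have -> : \sum_(p <- s) \sum_(q <- s) p.1^* * q.1 * G (L + L)%N p.2 q.2 =
    \sum_(0 <= n < L + L) u n * Q n.
  under [RHS]eq_bigr do rewrite mulr_sumr.
  rewrite [RHS]exchange_big; apply: eq_bigr => p _.
  under [RHS]eq_bigr do rewrite mulr_sumr.
  rewrite [RHS]exchange_big; apply: eq_bigr => q _.
  by rewrite mulr_sumr; apply: eq_bigr => n _; rewrite mulrCA.
have -> : \sum_(p <- s) \sum_(q <- s) p.1^* * q.1 * G L p.2 q.2 ^+ 2 =
    \sum_(0 <= k < L) \sum_(0 <= l < L) u k * u l * Q (k + l)%N.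
  transitivity (\sum_(p <- s) \sum_(q <- s) \sum_(0 <= k < L) \sum_(0 <= l < L)
      u k * u l * (p.1^* * q.1 * inner (e p.2) (e q.2) ^+ (k + l))).
    apply: eq_bigr => p _; apply: eq_bigr => q _.
    rewrite expr2 /G mulr_suml mulr_sumr; apply: eq_bigr => k _.
    rewrite !mulr_sumr; apply: eq_bigr => l _.
    by rewrite exprD; ring.
  under eq_bigr do rewrite exchange_big /=.
  rewrite exchange_big /=; apply: eq_bigr => k _.
  under eq_bigr do rewrite exchange_big /=.
  rewrite exchange_big /=; apply: eq_bigr => l _.
  rewrite /Q mulr_sumr; apply: eq_bigr => p _.
  by rewrite mulr_sumr.
rewrite subr_ge0; apply: le_trans (sum_square_le_triangle _ _) _.
  by move=> k l; rewrite !mulr_ge0.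
rewrite mulr_sumr; apply: ler_sum_nat => n _.
have -> : \sum_(0 <= k < n.+1) u k * u (n - k)%N * Q (k + (n - k))%N =
    (\sum_(k < n.+1) w k ^- 2 * w (n - k)%N ^- 2)%:C%C * Q n.
  rewrite big_mkord rmorph_sum mulr_suml; apply: eq_bigr => k _.
  by rewrite subnKC -1?ltnS// rmorphM.
by rewrite mulrA -rmorphM ler_wpM2r// lecR.
Qed.

End Exponentials.

(** * Totality of the torus *)

Lemma wedge_scale (R : realType) (H : hilbertType R) (w : nat -> R) c (x : H) s :
  wedge w (c *: x :: s) = c *: wedge w (x :: s).
Proof.
have W0 : wedge w (0 :: s) = 0.
  have := wedge_linear w 1 0 0 s; rewrite scaler0 addr0 scale1r => /eqP.
  by rewrite -subr_eq subrr eq_sym => /eqP.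
by have := wedge_linear w c x 0 s; rewrite addr0 W0 addr0.
Qed.

Lemma wedge_scale_nseq (R : realType) (H : hilbertType R) (w : nat -> R) c (x : H) s n :
  wedge w (s ++ nseq n (c *: x)) = c ^+ n *: wedge w (s ++ nseq n x).
Proof.
elim: n s => [|n IH] s; first by rewrite scale1r.
rewrite (wedge_perm _ (perm_cat_cons _ _ _)) wedge_scale -cat_cons.
rewrite (wedge_perm _ (t := (x :: s) ++ nseq n (c *: x)))//.
rewrite IH scalerA -exprS; congr (_ *: _); apply: wedge_perm.
by rewrite perm_sym perm_cat_cons.
Qed.

Section Torus.
Variables (R : realType) (H : hilbertType R) (phi : nat -> H) (a : nat -> R).
Hypothesis phi_on : forall i j, inner (phi i) (phi j) = (i == j)%:R.
Hypothesis a_l2 : cvgn (series (fun j => a j ^+ 2)).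
Local Notation C := R[i].
Local Notation torus z := (forall j, `|(z : nat -> C) j| = 1).

Definition torus_point (z : nat -> C) : H :=
  limn (series (fun j => (a j)%:C%C * z j *: phi j)).

Lemma norm_orthonormal_sum (c : nat -> C) m k :
  `|\sum_(m <= j < k) c j *: phi j| ^+ 2 = \sum_(m <= j < k) `|c j| ^+ 2.
Proof.
rewrite -inner_norm inner_suml; apply: eq_big_nat => n nmk.
rewrite inner_sumr (bigD1_seq n) ?mem_index_iota ?iota_uniq//= big1 ?addr0.
  by rewrite innerZl innerZr phi_on eqxx mulr1 mulrC -normCK.
by move=> j jn; rewrite innerZl innerZr phi_on eq_sym (negPf jn) !mulr0.
Qed.

Let norm_torus_sum z m k : torus z ->
  `|\sum_(m <= j < k) ((a j)%:C%C * z j) *: phi j| ^+ 2 =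
  (\sum_(m <= j < k) a j ^+ 2)%:C%C.
Proof.
move=> z1; rewrite norm_orthonormal_sum rmorph_sum; apply: eq_bigr => j _.
rewrite normrM z1 mulr1 rmorphXn/= -normrX ger0_norm// -rmorphXn/=.
by rewrite ler0c sqr_ge0.
Qed.

Lemma torus_point_cvg z : torus z ->
  series (fun j => (a j)%:C%C * z j *: phi j) @ \oo --> torus_point z.
Proof.
move=> z1; apply: cauchy_seq_cvg => e e0.
have e20 : 0 < e ^+ 2 by rewrite exprn_gt0.
have [d dE] := complex_realP _ (gtr0_real e20).
have d0 : 0 < d by move: e20; rewrite dE ltcR.
have /cauchy_cvgP/cauchy_seriesP/(_ _ d0) := a_l2.
case=> -[A B] [/= [NA _ AP] [NB _ BP]] AB.
exists (maxn NA NB) => n Nn; rewrite distrC sub_series_geq//.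
rewrite -ler_sqr ?nnegrE ?(ltW e0)// norm_torus_sum// dE lecR.
apply/ltW; apply: le_lt_trans (ler_norm _) _.
apply: (AB (maxn NA NB, n)); split; [apply: AP|apply: BP] => /=.
  exact: leq_maxl.
by rewrite (leq_trans _ Nn)// leq_maxr.
Qed.

Lemma norm_torus_point z : torus z ->
  `|torus_point z| <= (Num.sqrt (limn (series (fun j => a j ^+ 2))))%:C%C.
Proof.
move=> z1; apply: (cvg_norm_le (torus_point_cvg z1) (N := 0)) => n _.
rewrite -ler_sqr ?nnegrE ?ler0c ?sqrtr_ge0// norm_torus_sum// -rmorphXn/= lecR.
have le n' : series (fun j => a j ^+ 2) n' <= limn (series (fun j => a j ^+ 2)).
  by apply: nondecreasing_cvgn_le => //; apply: nondecreasing_series => j _ _; exact: sqr_ge0.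
rewrite sqr_sqrtr; first exact: le.
by have := le 0%N; rewrite /series /= big_geq.
Qed.

(** The coordinates of the torus point from [N] on. *)
Let tail N z := torus_point z - \sum_(0 <= j < N) ((a j)%:C%C * z j) *: phi j.

Let tail_scale c z N : torus z -> `|c| = 1 ->
  tail N (fun j => c * z j) = c *: tail N z.
Proof.
move=> z1 c1; have cz1 : torus (fun j => c * z j) by move=> j; rewrite normrM c1 z1 mulr1.
have sumE M : \sum_(0 <= j < M) ((a j)%:C%C * (c * z j)) *: phi j =
    c *: \sum_(0 <= j < M) ((a j)%:C%C * z j) *: phi j.
  by rewrite scaler_sumr; apply: eq_bigr => j _; rewrite scalerA mulrCA.
rewrite /tail sumE scalerBr; congr (_ - _).
have cv := cvgZr (k := c) (torus_point_cvg z1).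
have cv' := torus_point_cvg cz1.
have E : series (fun j => (a j)%:C%C * (c * z j) *: phi j) =
   (fun n => c *: series (fun j => (a j)%:C%C * z j *: phi j) n).
  by apply/funext => M; exact: sumE.
rewrite E in cv'.
by have := cvg_unique (@norm_hausdorff _ _) cv'; apply; exact: cv.
Qed.

(** Isolates coordinate [N] and leaves [tail N.+1 z] fixed, in the form [y + c *: x] of the binomial
    formula. *)
Let tail_set z N c : torus z -> `|c| = 1 ->
  tail N (fun j => if j == N then c else z j) = tail N.+1 z + ((a N)%:C%C * c) *: phi N.
Proof.
move=> z1 c1; pose z' j := if j == N then c else z j.
have z'1 : torus z' by move=> j; rewrite /z'; case: eqP.
have sumE M : (N < M)%N -> \sum_(0 <= j < M) ((a j)%:C%C * z' j) *: phi j =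
    \sum_(0 <= j < M) ((a j)%:C%C * z j) *: phi j + ((a N)%:C%C * (c - z N)) *: phi N.
  move=> NM; rewrite !(bigD1_seq N) ?mem_index_iota ?iota_uniq//= {1}/z' eqxx.
  rewrite (eq_bigr (fun j => ((a j)%:C%C * z j) *: phi j)) => [|j jN]; last first.
    by rewrite /z' (negPf jN).
  by rewrite addrAC -scalerDl; congr (_ *: _ + _); ring.
have pE : torus_point z' = torus_point z + ((a N)%:C%C * (c - z N)) *: phi N.
  have cv : (fun M => series (fun j => (a j)%:C%C * z j *: phi j) M +
      ((a N)%:C%C * (c - z N)) *: phi N) @ \oo -->
      torus_point z + ((a N)%:C%C * (c - z N)) *: phi N.
    by apply: cvgD; [exact: torus_point_cvg | exact: cvg_cst].
  have cv' := torus_point_cvg z'1.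
  have := cvg_unique (@norm_hausdorff _ _) cv'; apply.
  apply: cvg_trans cv; apply: near_eq_cvg; exists N.+1 => // M /= NM.
  by rewrite /series /= sumE.
rewrite /tail -/z' pE big_nat_recr//= opprD.
rewrite (eq_big_nat _ _ (F2 := fun j => ((a j)%:C%C * z j) *: phi j))
  => [|j /andP[_ jN]]; last first.
  by rewrite /z' ltn_eqF.
rewrite mulrBr scalerBl [LHS]addrAC [in RHS]addrA -[RHS]addrA.
by congr (_ + _); rewrite addrC.
Qed.

Section Total.
Variable w : nat -> R.
Hypothesis w_gt0 : forall n, 0 < w n.
Let rho := Num.sqrt (limn (series (fun j => a j ^+ 2))).
Hypothesis rho_cvg : cvgn (series (fun n => w n ^- 2 * rho ^+ (2 * n))).
Hypothesis a_gt0 : forall j, 0 < a j.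
Variable f : fock H w.
Hypothesis f_perp : forall z, torus z -> inner (fock_exp w (torus_point z)) f = 0.

Let F s : C := inner (wedge w s) f.

Let F_perm s t : perm_eq s t -> F s = F t.
Proof. by move=> st; rewrite /F (wedge_perm w st). Qed.

(* [vanishing s N] holds for [s = [::]] and [N = 0] with [b n = w n ^- 2], as
   the sums are then partial sums of [<fock_exp w (torus_point z), f> = 0].
   Reading the sums as polynomials in the conjugate of [z N], bounded on the
   circle, it passes to [s ++ nseq k (phi N)] and [N.+1]. *)
Let vanishing s N := exists2 b : nat -> R, (forall n, 0 < b n) &
  forall e : C, 0 < e -> exists L0, forall L z, (L0 <= L)%N -> torus z ->
    `|\sum_(n < L) (b n)%:C%C * F (s ++ nseq n (tail N z))| <= e.

Let vanishing0 : vanishing [::] 0.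
Proof.
exists (fun n => w n ^- 2) => [n|e e0]; first by rewrite invr_gt0 exprn_gt0.
have f1 : 0 < `|f| + 1 by rewrite ltr_wpDl.
have [N NP] := fock_exp_tail H w_gt0 rho_cvg (divr_gt0 e0 f1).
exists N => L z NL z1.
have -> : \sum_(n < L) (w n ^- 2)%:C%C * F ([::] ++ nseq n (tail 0 z)) =
    inner (series (fun n => (w n ^- 2)%:C%C *: wedge w (nseq n (torus_point z))) L) f.
  rewrite /series /= inner_suml big_mkord; apply: eq_bigr => n _.
  rewrite innerZl /tail big_geq// subr0; congr (_ * _).
  by apply/esym/CrealP/ger0_real; rewrite ler0c invr_ge0 exprn_ge0// ltW.
(* The full exponential vector is orthogonal to [f], so only its tail remains, which is small
   uniformly in [z]. *)
rewrite -[X in `|X|]subr0 -(f_perp z1) -innerBl.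
rewrite (le_trans (inner_CS _ _))// distrC.
apply: (@le_trans _ _ (e / (`|f| + 1) * `|f|)).
  by rewrite ler_wpM2r// NP// norm_torus_point.
by rewrite mulrAC ler_pdivrMr// ler_pM2l// lerDl.
Qed.

Let vanishingS s N k : vanishing s N -> vanishing (s ++ nseq k (phi N)) N.+1.
Proof.
(* With [n = m + k], this is the coefficient of the words containing [k] new copies of [phi N] in
   the binomial expansion, without the factor [a N ^+ k]. That positive factor is put into the
   tolerance and divided out. *)
case=> b b0 bP; exists (fun m => b (m + k)%N * 'C(m + k, k)%:R) => [m|e e0].
  by rewrite mulr_gt0// ltr0n bin_gt0 leq_addl.
have ak : 0 < ((a N)%:C%C : C) ^+ k by rewrite exprn_gt0// (ltcR 0).
have [L0 LP] := bP _ (mulr_gt0 e0 ak).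
(* The successor forces [L > 0], so that [k] is a valid index below [L + k]. *)
exists L0.+1 => L z L0L z1; set t := tail N.+1 z.
(* The coefficient of [y ^+ j] when coordinate [N] is [y^*]: [F] is conjugate-linear in each letter
   and turns powers of [y^*] into powers of [y]. The cutoff [L + k] leaves exactly [L] terms in
   [c k]. *)
pose c j : C := \sum_(j <= n < L + k) (b n)%:C%C * ('C(n, j)%:R * (a N)%:C%C ^+ j) *
  F ((s ++ nseq j (phi N)) ++ nseq (n - j) t).
suff : `|c k| <= e * (a N)%:C%C ^+ k.
  have -> : c k = (\sum_(n < L) (b (n + k)%N * 'C(n + k, k)%:R)%:C%C *
      F ((s ++ nseq k (phi N)) ++ nseq n t)) * (a N)%:C%C ^+ k.
    rewrite /c -{1}[k]add0n big_addn addnK big_mkord mulr_suml.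
    apply: eq_bigr => n _; rewrite addnK rmorphM/= rmorph_nat; ring.
  by rewrite normrM [X in _ * X]gtr0_norm// ler_pM2r.
apply: (@circle_coef_le _ (L + k)%N); last by rewrite -[k.+1]add1n leq_add2r (leq_trans _ L0L).
move=> y y1; have y1' : `|y^*| = 1 by rewrite norm_conjC.
pose z' j := if j == N then y^* else z j.
have z'1 : torus z' by move=> j; rewrite /z'; case: eqP.
have -> : \sum_(j < L + k) c j * y ^+ j =
    \sum_(n < L + k) (b n)%:C%C * F (s ++ nseq n (tail N z')).
  have aR : ((a N)%:C%C : C)^* = (a N)%:C%C.
    by apply/CrealP/ger0_real; rewrite ler0c ltW.
  rewrite -(big_mkord xpredT (fun j => c j * y ^+ j)).
  rewrite -(big_mkord xpredT (fun n => (b n)%:C%C * F (s ++ nseq n (tail N z')))).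
  transitivity (\sum_(0 <= j < L + k) \sum_(0 <= n < L + k | (j <= n)%N)
      (b n)%:C%C * ('C(n, j)%:R * (a N)%:C%C ^+ j) * y ^+ j *
      F ((s ++ nseq j (phi N)) ++ nseq (n - j) t)).
    apply: eq_bigr => j _; rewrite mulr_suml (big_nat_widenl j 0)//.
    by apply: eq_bigr => n _; ring.
  rewrite (exchange_big_dep predT)//=; apply: eq_big_nat => n /andP[_ nL].
  rewrite -(big_nat_widen 0 n.+1 (L + k) xpredT)// big_mkord.
  rewrite /F tail_set// -/t wedge_binomial inner_suml mulr_sumr.
  apply: eq_bigr => j _; rewrite innerZl rmorphM/= rmorph_nat rmorphXn/= rmorphM/= aR conjCK.
  by rewrite exprMn; ring.
by apply: LP => //; rewrite (leq_trans (ltnW L0L))// leq_addr.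
Qed.

(** Rotating all remaining coordinates by [y^*] turns the sums into polynomials in [y], bounded by
    [e] on the circle, with constant coefficient [b 0 * F s]. *)
Let vanishing_eq0 s N : vanishing s N -> F s = 0.
Proof.
case=> b b0 bP; apply/eqP; rewrite -normr_le0.
have b00 : 0 < (b 0%N)%:C%C :> C by rewrite (ltcR 0).
rewrite -(ler_pM2l b00) mulr0 -[(b 0%N)%:C%C in leLHS]gtr0_norm// -normrM.
apply: (@le_eps _ _ _ 1) => // e e0 _; rewrite add0r mulr1.
have [L0 LP] := bP _ e0.
pose z : nat -> C := fun=> 1; have z1 : torus z by move=> j; rewrite normr1.
have := @circle_coef_le _ L0.+1
  (fun n => (b n)%:C%C * F (s ++ nseq n (tail N z))) e _ 0%N.
rewrite cats0; apply=> // y y1; have y1' : `|y^*| = 1 by rewrite norm_conjC.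
have := LP L0.+1 (fun j => y^* * z j) (leqnSn _); rewrite tail_scale// => LP'.
rewrite (eq_bigr (fun n : 'I_L0.+1 =>
  (b n)%:C%C * F (s ++ nseq n (y^* *: tail N z)))) => [|n _].
  by apply: LP' => j; rewrite normrM y1' z1 mulr1.
by rewrite /F wedge_scale_nseq innerZl rmorphXn/= conjCK; ring.
Qed.

(** Induction on the number [M] of indices still allowed: all copies of [N] move into the prefix,
    and the remaining indices are at least [N.+1]. *)
Let vanishing_words M : forall N s js, vanishing s N ->
  all (fun j => (N <= j < N + M)%N) js -> F (s ++ map phi js) = 0.
Proof.
elim: M => [|M IH] N s js sN.
  case: js => [_|j js /= /andP[]]; first by rewrite cats0; exact: vanishing_eq0 sN.
  by rewrite addn0 => /andP[/leq_ltn_trans h /h]; rewrite ltnn.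
move=> /allP jsP.
have fE : [seq x <- js | pred1 N x] = nseq (count_mem N js) N.
  by rewrite -size_filter; apply/all_pred1P; exact: filter_all.
have -> : F (s ++ map phi js) = F ((s ++ nseq (count_mem N js) (phi N)) ++
    map phi [seq x <- js | predC (pred1 N) x]).
  apply: F_perm; rewrite -catA perm_cat2l -map_nseq -map_cat -fE.
  by apply: perm_map; rewrite perm_sym (perm_filterC (pred1 N) js).
apply: (IH N.+1); first exact: vanishingS.
apply/allP => j; rewrite mem_filter /= => /andP[jN /jsP /andP[Nj jM]].
by rewrite ltn_neqAle eq_sym jN Nj /= addSnnS.
Qed.

Hypothesis phi_span : forall x : H, series (fun j => inner (phi j) x *: phi j) @ \oo --> x.

(** The arbitrary letters [xs] are approximated one at a time by partial sums of their basis
    expansions; [norm_wedge] makes [F] continuous in a letter. *)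
Let F_words xs js : F (map phi js ++ xs) = 0.
Proof.
elim: xs js => [|x xs IH] js.
  rewrite cats0 -[map _ _]cat0s; apply: (vanishing_words (M := (\max_(j <- js) j).+1) vanishing0).
  by apply/allP => j jjs; rewrite add0n ltnS /=; exact: leq_bigmax_seq.
rewrite (F_perm (perm_cat_cons _ _ _)); set s := map phi js ++ xs.
have F0 n : F (series (fun j => inner (phi j) x *: phi j) n :: s) = 0.
  elim: n => [|n IHn].
    rewrite /series /= big_geq// -(scale0r (0 : H)) /F wedge_scale innerZl.
    by rewrite rmorph0 mul0r.
  have -> : series (fun j => inner (phi j) x *: phi j) n.+1 =
      inner (phi n) x *: phi n + series (fun j => inner (phi j) x *: phi j) n.
    by rewrite /series /= big_nat_recr//= addrC.
  rewrite /F wedge_linear innerDl innerZl -/(F _) -/(F (_ :: s)) IHn addr0.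
  by rewrite /s -cat_cons -map_cons IH mulr0.
pose B : C := (w (size s).+1)%:C%C * \prod_(y <- s) `|y| * `|f|.
have B0 : 0 <= B by rewrite !mulr_ge0 ?prodr_ge0// ler0c ltW.
apply: (@norm_le_eps0 _ _ B) => // e e0 _.
have := @phi_span x; move/cvgrPdist_le => /(_ e e0)[N _ /(_ N (leqnn N)) /= xN].
set p := series _ N in xN; have := F0 N; rewrite -/p => Fp.
have -> : F (x :: s) = F (x - p :: s).
  rewrite [x - p]addrC -scaleN1r /F wedge_linear innerDl innerZl -/(F (p :: s)) Fp.
  by rewrite mulr0 add0r.
rewrite (le_trans (inner_CS _ _))// /B !mulrA ler_wpM2r//.
rewrite (le_trans (norm_wedge _ w_gt0))//= big_cons mulrCA -mulrA.
by rewrite ler_wpM2r// mulr_ge0 ?prodr_ge0// ler0c ltW.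
Qed.

Lemma torus_total : f = 0.
Proof.
by apply: fock_ext => s; rewrite inner0r; exact: (F_words s [::]).
Qed.

End Total.
End Torus.

(** * The Fock product and its characters *)

Lemma inner_tens2 (R : realType) (H1 H2 : hilbertType R) (x x' : H1) (y y' : H2) :
  inner (tens2 x y) (tens2 x' y') = inner x x' * inner y y'.
Proof. by rewrite kvec_inner. Qed.

Lemma norm_tens2 (R : realType) (H1 H2 : hilbertType R) (x : H1) (y : H2) :
  `|tens2 x y| = `|x| * `|y|.
Proof.
apply/eqP; rewrite -(@eqrXn2 _ 2) ?mulr_ge0// exprMn -!inner_norm.
by rewrite inner_tens2.
Qed.

(** Inner products of diagonal tensors are squares of those of the [v x], so the kernel inequality
    compares squared norms; hence the square root of [M]. *)
Lemma norm_comb_tens2 (R : realType) (H : hilbertType R) (X : Type) (v : X -> H)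
    (M : R[i]) (s : seq (R[i] * X)) : 0 <= M ->
  \sum_(p <- s) \sum_(q <- s) p.1^* * q.1 * inner (v p.2) (v q.2) ^+ 2 <=
  M * \sum_(p <- s) \sum_(q <- s) p.1^* * q.1 * inner (v p.2) (v q.2) ->
  `|\sum_(p <- s) p.1 *: tens2 (v p.2) (v p.2)| <=
  sqrtC M * `|\sum_(p <- s) p.1 *: v p.2|.
Proof.
move=> M0 sM; have sM0 : 0 <= sqrtC M by rewrite sqrtC_ge0.
rewrite -ler_sqr ?nnegrE ?mulr_ge0// exprMn [sqrtC M ^+ 2]sqrtCK.
rewrite (norm_sum2 v) [leLHS](norm_sum2 (fun x => tens2 (v x) (v x))).
move: sM; congr (_ <= _); apply: eq_bigr => p _; apply: eq_bigr => q _.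
by rewrite inner_tens2 expr2.
Qed.

(** * Kernel spaces of Gram kernels *)

Section GramSpace.
Variables (R : realType) (H : hilbertType R) (X : Type) (v : X -> H).
Variable K : pd_kernel R X.
Hypothesis KE : forall x y, K x y = inner (v x) (v y).

Let norm_kvec_comb (s : seq (R[i] * X)) :
  `|\sum_(p <- s) p.1 *: kvec K p.2| = `|\sum_(p <- s) p.1 *: v p.2|.
Proof.
apply/eqP; rewrite -(@eqrXn2 _ 2)//.
rewrite (norm_sum2 v) (norm_sum2 (kvec K)); apply/eqP.
by apply: eq_bigr => p _; apply: eq_bigr => q _; rewrite kvec_inner KE.
Qed.

(** The [kvec K x] and the [v x] have the same Gram kernel, so corresponding combinations have equal
    norms and interpolation transfers vectors. With the converse below, the kernel space is the set
    of functions [x |-> <v x, f>]. *)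
Lemma gram_space_inner (g : kernel_space K) : exists f, forall x, g x = inner (v x) f.
Proof.
have [s|f fg _] := @interpolation _ _ _ v g `|g| (normr_ge0 _); last by exists f.
rewrite -norm_kvec_comb mulrC.
rewrite (eq_bigr (fun p => p.1^* * inner (kvec K p.2) g)) => [|p _].
  by rewrite -inner_comb inner_CS.
by rewrite kvec_repr.
Qed.

Lemma inner_gram_space (f : H) : exists g : kernel_space K, forall x, g x = inner (v x) f.
Proof.
have [s|g gf _] := @interpolation _ _ _ (kvec K) (fun x => inner (v x) f) `|f| (normr_ge0 _).
  by rewrite norm_kvec_comb mulrC -inner_comb inner_CS.
by exists g => x; rewrite -gf kvec_repr.
Qed.

End GramSpace.

(** Combinations of words are dense. This extends identities from words to the whole Fock space, one
    argument at a time. *)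
Lemma fock_functional_eq0 (R : realType) (H : hilbertType R) (w : nat -> R)
    (l : fock H w -> R[i]) (M : R[i]) : 0 <= M ->
  (forall c f g, l (c *: f + g) = c * l f + l g) ->
  (forall f, `|l f| <= M * `|f|) -> (forall s, l (wedge w s) = 0) ->
  forall f, l f = 0.
Proof.
move=> M0 llin lM lw f; apply: (@norm_le_eps0 _ _ M) => // e e0 _.
have [s fs] := kcomb_dense f e0.
have l0 : l 0 = 0.
  by have := llin (-1) 0 0; rewrite scaler0 addr0 mulN1r addNr.
have ls : l (kcomb _ s) = 0.
  rewrite kcombE; elim: s {fs} => [|p s IH]; first by rewrite big_nil.
  by rewrite big_cons llin IH addr0 [l _]lw mulr0.
have -> : l f = l (f - kcomb _ s).
  by rewrite addrC -scaleN1r llin ls mulr0 add0r.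
by rewrite (le_trans (lM _))// mulrC ler_wpM2r.
Qed.

Section FockProduct.
Variables (R : realType) (H : hilbertType R) (w : nat -> R) (K : R).
Hypothesis w_gt0 : forall n, 0 < w n.
Hypothesis w_l2 : cvgn (series (fun n => w n ^- 2)).
Hypothesis w_conv : forall n,
  \sum_(k < n.+1) w k ^- 2 * w (n - k)%N ^- 2 <= K * w n ^- 2.
Variable phi : nat -> H.
Hypothesis phi_basis : is_orthonormal_basis phi.
Local Notation C := R[i].

Let KC0 : 0 <= K%:C%C :> C.
Proof. by rewrite ler0c ltW// (conv_const_gt0 w_gt0 w_conv). Qed.

Lemma fock_product_exists : exists m, is_fock_product (H := H) (w := w) m.
Proof.
have [phi_on phi_span] := phi_basis.
(* An auxiliary positive sequence with squared norm [1/3]; as [rho <= 1], the series at [rho] is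
   dominated by that of [w n ^- 2]. *)
pose a j : R := 2^-1 * 2^-1 ^+ j.
have a0 j : 0 < a j by rewrite mulr_gt0 ?exprn_gt0.
have a2 : series (fun j => a j ^+ 2) @ \oo --> (4^-1 / (1 - 4^-1) : R).
  have -> : (fun j => a j ^+ 2) = geometric (4^-1) (4^-1).
    apply/funext => j; rewrite /a /= exprMn -exprM mulnC exprM.
    by rewrite (_ : 2^-1 ^+ 2 = 4^-1 :> R)//; field.
  by apply: cvg_geometric_series; rewrite gtr0_norm ?invr_gt0// invf_lt1// ltr1n.
have a_l2 := cvgP _ a2.
set rho := Num.sqrt (limn (series (fun j => a j ^+ 2))).
have rho1 : rho <= 1.
  rewrite /rho (_ : limn _ = 4^-1 / (1 - 4^-1) :> R); last exact: cvg_lim.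
  by rewrite -[leRHS]sqrtr1 ler_wsqrtr// ler_pdivrMr; lra.
have rho_cvg : cvgn (series (fun n => w n ^- 2 * rho ^+ (2 * n))).
  apply: series_le_cvg w_l2 => n.
  - by rewrite mulr_ge0 ?exprn_ge0 ?sqrtr_ge0// invr_ge0 exprn_ge0// ltW.
  - by rewrite invr_ge0 exprn_ge0// ltW.
  - rewrite ger_pMr ?invr_gt0 ?exprn_gt0//.
    by rewrite exprn_ile1// sqrtr_ge0.
pose X := {z : nat -> C | forall j, `|z j| = 1}.
pose e (x : X) : H := torus_point phi a (sval x).
have e_rho x : `|e x| <= rho%:C%C by apply: norm_torus_point => //; exact: svalP x.
pose v x := fock_exp w (e x).
have v_ext f g : (forall x, inner (v x) f = inner (v x) g) -> f = g.
  move=> fg; apply/eqP; rewrite -subr_eq0; apply/eqP.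
  apply: (torus_total phi_on a_l2 w_gt0 rho_cvg a0) => // z z1.
  by have := fg (exist _ z z1); rewrite innerBr => ->; rewrite subrr.
(* The product is defined weakly: its prescribed value at [x] is the pairing of [tens2 (v x) (v x)]
   with [tens2 f g], which the kernel inequality bounds. *)
have ex f g : exists2 y, (forall x, inner (v x) y = inner (v x) f * inner (v x) g) &
    `|y| <= sqrtC K%:C%C * `|f| * `|g|.
  apply: interpolation => [|s]; first by rewrite !mulr_ge0// sqrtC_ge0.
  rewrite (eq_bigr (fun p => p.1^* * inner (tens2 (v p.2) (v p.2)) (tens2 f g))).
    rewrite -(inner_comb (fun x => tens2 (v x) (v x))) (le_trans (inner_CS _ _))//.
    rewrite norm_tens2 [leRHS](_ : _ = (sqrtC K%:C%C *
      `|\sum_(p <- s) p.1 *: v p.2|) * (`|f| * `|g|)); last by ring.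
    rewrite ler_wpM2r ?mulr_ge0//; apply: norm_comb_tens2 => //.
    exact: (fock_exp_kernel_sq w_gt0 rho_cvg).
  by move=> p _; rewrite inner_tens2.
pose m f g := s2val (cid2 (ex f g)).
have mE f g x : inner (v x) (m f g) = inner (v x) f * inner (v x) g :=
  s2valP (cid2 (ex f g)) x.
have mM f g : `|m f g| <= sqrtC K%:C%C * `|f| * `|g| := s2valP' (cid2 (ex f g)).
exists m; split.
- by move=> f c g h; apply: v_ext => x; rewrite !(innerDr, innerZr) !mE !(innerDr, innerZr); ring.
- by move=> f c g h; apply: v_ext => x; rewrite !(innerDr, innerZr) !mE !(innerDr, innerZr); ring.
- by exists (sqrtC K%:C%C).
- move=> s t; apply: v_ext => x; rewrite mE !(inner_fock_exp_wedge w_gt0 rho_cvg)//.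
  by rewrite big_cat.
Qed.

Lemma fock_mulP : is_fock_product (@fock_mul R H w).
Proof. by rewrite /fock_mul; case: xgetP => // h; have [m /h] := fock_product_exists. Qed.

(** On words, multiplicativity is the splitting of a product over a concatenation. The defect is
    bounded in each argument, so it vanishes first for all second arguments, then for all first
    ones. *)
Lemma fock_exp_character (rho : R) (eta : H) :
  cvgn (series (fun n => w n ^- 2 * rho ^+ (2 * n))) -> `|eta| <= rho%:C%C ->
  is_character (fun f : fock H w => inner (fock_exp w eta) f).
Proof.
move=> rho_cvg eta_rho; have [mlin mlin' [M mM] mw] := fock_mulP.
set xi := fock_exp w eta.
have xiw s : inner xi (wedge w s) = \prod_(x <- s) inner eta x.
  exact: (inner_fock_exp_wedge w_gt0 rho_cvg).
split => [c f g||]; first by rewrite innerDr innerZr.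
  by exists (wedge w [::]); rewrite xiw big_nil oner_neq0.
(* The constant [M] comes without a sign and is replaced by its modulus. *)
have mM' (f' g' : fock H w) : `|fock_mul f' g'| <= `|M| * `|f'| * `|g'|.
  apply: le_trans (mM f' g') _; rewrite (le_trans (real_ler_norm _))//.
    by rewrite ger0_real// (le_trans (normr_ge0 _) (mM _ _)).
  by rewrite !normrM !normr_id.
have bnd (f' g' : fock H w) : `|inner xi (fock_mul f' g') - inner xi f' * inner xi g'| <=
    (`|xi| * `|M| + `|xi| * `|xi|) * `|f'| * `|g'|.
  rewrite (le_trans (ler_normB _ _))// -mulrA mulrDl lerD//.
    rewrite (le_trans (inner_CS _ _))// -mulrA ler_wpM2l// mulrA.
    exact: mM'.
  rewrite normrM (_ : `|xi| * `|xi| * _ = (`|xi| * `|f'|) * (`|xi| * `|g'|)); last by ring.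
  by rewrite ler_pM ?inner_CS.
have c0 : 0 <= `|xi| * `|M| + `|xi| * `|xi| by rewrite addr_ge0 ?mulr_ge0.
have word s g : inner xi (fock_mul (wedge w s) g) = inner xi (wedge w s) * inner xi g.
  apply/eqP; rewrite -subr_eq0; apply/eqP; move: g.
  apply: (fock_functional_eq0 (M := (`|xi| * `|M| + `|xi| * `|xi|) * `|wedge w s|)).
  - by rewrite mulr_ge0.
  - by move=> c g h; rewrite mlin !(innerDr, innerZr); ring.
  - by move=> g; exact: bnd.
  - by move=> t; rewrite mw !xiw big_cat subrr.
move=> f g; apply/eqP; rewrite -subr_eq0; apply/eqP; move: f.
apply: (fock_functional_eq0 (M := (`|xi| * `|M| + `|xi| * `|xi|) * `|g|)).
- by rewrite mulr_ge0.
- by move=> c f h; rewrite mlin' !(innerDr, innerZr); ring.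
- by move=> f; rewrite mulrAC; exact: bnd.
- by move=> s; rewrite word subrr.
Qed.

End FockProduct.

(** * Restriction of the Gelfand image to the torus *)

Theorem proposition11 (R : realType) (H : hilbertType R) (w : nat -> R)
  (w_gt0 : forall n, 0 < w n)
  (w0 : w 0%N = 1)
  (w_l2 : cvgn (series (fun n => w n ^- 2)))
  (w_conv : exists C : R, forall n,
    \sum_(k < n.+1) w k ^- 2 * w (n - k)%N ^- 2 <= C * w n ^- 2)
  (phi : nat -> H) (phi_basis : is_orthonormal_basis phi)
  (a : nat -> R) (a_ge0 : forall j, 0 <= a j)
  (a_l2 : cvgn (series (fun j => a j ^+ 2)))
  (a_le : ((Num.sqrt (limn (series (fun j => a j ^+ 2))))%:E <= fock_radius w)%E) :
  let T := complex_torus w phi a in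
  let K := pd_restrict (khat H w) T in
  [/\ forall z : nat -> R[i], (forall j, `|z j| = 1) ->
        is_character (fun f => inner (torus_vector w phi a z) f),
      forall h : T -> R[i],
        (exists g : kernel_space K, h = g) <->
        (exists f : fock H w, h = fun chi => gelfand f (set_val chi)),
      is_rkha K,
      forall g : kernel_space K, continuous (fun chi : T => g chi : R[i]^o) &
      (forall j, 0 < a j) ->
        forall h1 h2 : spectrum H w -> R[i],
          range (@gelfand R H w) h1 -> range (@gelfand R H w) h2 ->
          (forall chi, T chi -> h1 chi = h2 chi) -> h1 = h2].
Proof.
move=> T K; have [C wC] := w_conv; have [phi_on phi_span] := phi_basis.
have C0 : 0 <= C%:C%C :> R[i] by rewrite ler0c ltW// (conv_const_gt0 w_gt0 wC).
set rho := Num.sqrt _ in a_le.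
(* The norm of [a] may equal the radius, where convergence still holds. *)
have rho_cvg := radius_cvg w_gt0 wC w_l2 (sqrtr_ge0 _) a_le.
have eta_rho z : (forall j, `|z j| = 1) -> `|torus_point phi a z| <= rho%:C%C.
  exact: norm_torus_point.
have chr z (z1 : forall j, `|z j| = 1) :
    is_character (fun f : fock H w => inner (torus_vector w phi a z) f).
  exact: (fock_exp_character w_gt0 w_l2 wC phi_basis rho_cvg (eta_rho z z1)).
have repr (t : T) : exists2 z : nat -> R[i], (forall j, `|z j| = 1) &
    forall f, set_val (set_val t) f = inner (fock_exp w (torus_point phi a z)) f.
  by have /set_mem[z [z1 zE]] := valP t; exists z.
pose e (t : T) : H := torus_point phi a (s2val (cid2 (repr t))).
have e_rho t : `|e t| <= rho%:C%C by apply/eta_rho/(s2valP (cid2 (repr t))).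
pose v (t : T) : fock H w := fock_exp w (e t).
have vE (t : T) (f : fock H w) : set_val (set_val t) f = inner (v t) f := s2valP' (cid2 (repr t)) f.
(* Riesz vectors are unique, so the one chosen by [riesz] is [v t]. *)
have rieszE (t : T) : riesz (set_val t) = v t.
  rewrite /riesz; case: xgetP => [xi _ /= xiE|/(_ (v t))[]]; last exact: vE.
  by apply: inner_inj => f; rewrite inner_conj -xiE vE -inner_conj.
have KE (t t' : T) : K t t' = inner (v t) (v t') by rewrite /= !rieszE.
(* The restricted kernel is the Gram kernel of [v], so its space consists of the functions
   [t |-> <v t, f>], the restricted Gelfand transforms. *)
have Kfun := gram_space_inner KE; have funK := inner_gram_space KE.
split => //.
- move=> h; split=> [[g ->]|[f ->]].
    have [f gf] := Kfun g; exists f; apply/funext => t.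
    by rewrite /gelfand vE.
  have [g gf] := funK f; exists g; apply/funext => t.
  by rewrite /gelfand vE.
- have sC0 : 0 <= sqrtC C%:C%C :> R[i] by rewrite sqrtC_ge0.
  have [||D [DM Dk]] := @bounded_extension _ _ _ _ (kvec K)
      (fun t => tens2 (kvec K t) (kvec K t)) _ sC0.
  + by move=> y y0; apply/val_inj/funext => t; have := y0 t; rewrite kvec_repr.
  (* The inequality for exponential vectors transfers to the [kvec K t], whose inner products are
     the same. *)
  + move=> s; apply: norm_comb_tens2 => //.
    have := fock_exp_kernel_sq w_gt0 rho_cvg s wC e_rho; congr (_ <= _ * _).
      by do 2 (apply: eq_bigr => ? _); rewrite kvec_inner KE.
    by do 2 (apply: eq_bigr => ? _); rewrite kvec_inner KE.
  by exists D; split => //; exists (sqrtC C%:C%C).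
- move=> g; have [f gf] := Kfun g.
  (* [g] is evaluation at [f]: two subspace inclusions followed by a coordinate projection of the
     pointwise topology. *)
  have -> : (fun t : T => g t : R[i]^o) = (fun t : T => set_val (set_val t) f : R[i]^o).
    by apply/funext => t; rewrite gf vE.
  pose P := {ptws fock H w -> R[i]^o}.
  have valT : continuous (set_val : T -> spectrum H w) by exact: initial_continuous.
  have valS : continuous (set_val : spectrum H w -> P) by exact: initial_continuous.
  have evf : continuous (fun l : P => l f) by exact: proj_continuous.
  move=> t; apply: (@continuous_comp _ _ _ (set_val : T -> spectrum H w)
    (fun chi => set_val chi f : R[i]^o)); first exact: valT.
  apply: (@continuous_comp _ _ _ (set_val : spectrum H w -> P) (fun l : P => l f)).
    exact: valS.
  exact: evf.
(* Equality on the torus makes [f1 - f2] orthogonal to every torus vector, so totality gives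
   [f1 = f2]. *)
- move=> a_gt0 _ _ [f1 _ <-] [f2 _ <-] f12; congr gelfand.
  apply/eqP; rewrite -subr_eq0; apply/eqP.
  apply: (torus_total phi_on a_l2 w_gt0 rho_cvg a_gt0) => // z z1.
  pose chi : spectrum H w := SigSub (mem_set (chr z z1)).
  have Tchi : T chi by exists z.
  have f12z : inner (torus_vector w phi a z) f1 = inner (torus_vector w phi a z) f2.
    exact: f12 chi Tchi.
  by rewrite innerBr [X in X - _]f12z subrr.
Qed.
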